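(* Let $m,k,n\geq 1$ be integers and $W\in\{R,Q,D\}$. (i) If $\gcd(m,k)=1$, then $\mathbb{Z}_{mk}=\mathbb{Z}_m\oplus\mathbb{Z}_k$ and $\mathrm{tor}\,H_n^W(R_m)\oplus\mathrm{tor}\,H_n^W(R_k)\subset H_n^W(R_{mk})$. (ii) For $k$ odd, $\mathrm{tor}\,H_n^W(R_k)\oplus\mathrm{tor}\,H_n^W(R_k)\subset H_n^W(R_{2k})$. (iii) For $k$ an odd prime such that $\gcd(m,k)=1$, $H_3^Q(R_{mk})$ and $H_4^Q(R_{mk})$ contain $\mathbb{Z}_k$. (Here $\subset$ and ''contain'' mean: is isomorphic to a subgroup of, respectively contains a subgroup isomorphic to.)
   Context: $\mathbb{Z}_m=\mathbb{Z}/m\mathbb{Z}$; the dihedral quandle $R_m$ is the set $\mathbb{Z}_m$ with operation $a*b=2b-a$ modulo $m$. For a quandle $X$ and $n\ge1$, $C_n^R(X)=\mathbb{Z}X^n$ with boundary $$\partial(x_1,\ldots,x_n)=\sum_{i=2}^n(-1)^i\big((x_1,\ldots,x_{i-1},x_{i+1},\ldots,x_n)-(x_1*x_i,\ldots,x_{i-1}*x_i,x_{i+1},\ldots,x_n)\big)$$ (zero for $n=1$); $C_n^D(X)$ is the subcomplex generated by tuples with $x_i=x_{i+1}$ for some $i$; $C_n^Q(X)=C_n^R(X)/C_n^D(X)$. The corresponding homology groups are $H_n^R(X),H_n^D(X),H_n^Q(X)$. $\mathrm{tor}$ denotes the torsion subgroup. *)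

(* Defs.v *)
From HB Require Import structures.
From mathcomp Require Import freeg.
From mathcomp Require Import all_boot all_order all_algebra.
From mathcomp Require Import ring_quotient boolp.
From mathcomp Require Import zify.

Set Implicit Arguments.
Unset Strict Implicit.
Unset Printing Implicit Defensive.

Import GRing.Theory.
Local Open Scope ring_scope.
Local Open Scope quotient_scope.

Definition embeds (A B : zmodType) : Prop :=
  exists f : {additive A -> B}, injective f.

Definition isomorphic (A B : zmodType) : Prop :=
  exists f : {additive A -> B}, bijective f.

Section Subgroup.
Variables (V : zmodType) (S : zmodClosed V).

Record subgroup := Subgroup { subgroup_val : V; _ : subgroup_val \in S }.

HB.instance Definition _ := [isSub for subgroup_val].
HB.instance Definition _ := [Choice of subgroup by <:].
HB.instance Definition _ := [SubChoice_isSubZmodule of subgroup by <:].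
End Subgroup.

Section Torsion.
Variable V : zmodType.

Definition torsion : {pred V} :=
  [pred v | `[< exists2 r : nat, (0 < r)%N & v *+ r = 0 >]].

Fact torsion_zmod_closed : zmod_closed torsion.
Proof.
split=> [|u v /asboolP[r r0 ur] /asboolP[s s0 vs]]; apply/asboolP.
  by exists 1%N.
exists (r * s)%N; first by rewrite muln_gt0 r0.
by rewrite mulrnBl mulrnA ur mul0rn sub0r mulnC mulrnA vs mul0rn oppr0.
Qed.

HB.instance Definition _ := GRing.isZmodClosed.Build V torsion
  torsion_zmod_closed.

Definition tor : zmodType := subgroup torsion.
End Torsion.

(* The differential in degree 0 is an endomorphism of C 0 (as 0.-1 = 0), and
   the condition below forces it to square to zero. *)
Record chain_complex := ChainComplex {
  chains :> nat -> zmodType;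
  diff : forall n, {additive chains n -> chains n.-1};
  diffK : forall n (c : chains n), diff n.-1 (diff n c) = 0 }.

Section Homology.
Variables (C : chain_complex) (n : nat).

Definition cycle : {pred C n} := [pred c | diff C n c == 0].

Fact cycle_zmod_closed : zmod_closed cycle.
Proof.
split=> [|u v]; rewrite !inE ?raddf0 // => /eqP du /eqP dv.
by rewrite raddfB du dv subr0.
Qed.

HB.instance Definition _ := GRing.isZmodClosed.Build (C n) cycle
  cycle_zmod_closed.

Definition boundary : {pred subgroup cycle} :=
  [pred z | `[< exists c : C n.+1, diff C n.+1 c = val z >]].

Fact boundary_zmod_closed : zmod_closed boundary.
Proof.
split=> [|u v /asboolP[c du] /asboolP[c' dv]]; apply/asboolP.
  by exists 0; rewrite !raddf0.
by exists (c - c'); rewrite !raddfB /= du dv.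
Qed.

HB.instance Definition _ := GRing.isZmodClosed.Build (subgroup cycle) boundary
  boundary_zmod_closed.

Definition homology : zmodType := Quotient.quot boundary.
End Homology.

Section SubQuotientComplex.
Variables (C : chain_complex) (S : forall n, zmodClosed (C n)).
Hypothesis diffS : forall n (c : C n), c \in S n -> diff C n c \in S n.-1.

Definition sub_diff n (c : subgroup (S n)) : subgroup (S n.-1) :=
  Subgroup (diffS (valP c)).

Fact sub_diff_is_zmod_morphism n : zmod_morphism (@sub_diff n).
Proof. by move=> u v; apply: val_inj; rewrite /= !raddfB. Qed.

HB.instance Definition _ n := GRing.isZmodMorphism.Build _ _ (@sub_diff n)
  (@sub_diff_is_zmod_morphism n).

Fact sub_diffK n c : sub_diff (@sub_diff n c) = 0.
Proof. by apply: val_inj; rewrite raddf0 /= diffK. Qed.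

Definition subcomplex : chain_complex := ChainComplex sub_diffK.

Definition quot_diff n (c : Quotient.quot (S n)) : Quotient.quot (S n.-1) :=
  \pi_(Quotient.quot (S n.-1)) (diff C n (repr c)).

Lemma quot_diff_pi n (c : C n) :
  quot_diff (\pi_(Quotient.quot (S n)) c) =
  \pi_(Quotient.quot (S n.-1)) (diff C n c).
Proof.
apply/eqP; rewrite /quot_diff -Quotient.idealrBE -raddfB; apply: diffS.
by rewrite Quotient.idealrBE reprK.
Qed.

Fact quot_diff_is_zmod_morphism n : zmod_morphism (@quot_diff n).
Proof.
move=> u v; rewrite -[u]reprK -[v]reprK -raddfB !quot_diff_pi.
by rewrite -!raddfB.
Qed.

HB.instance Definition _ n := GRing.isZmodMorphism.Build _ _ (@quot_diff n)
  (@quot_diff_is_zmod_morphism n).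

Fact quot_diffK n c : quot_diff (@quot_diff n c) = 0.
Proof. by rewrite -[c]reprK !quot_diff_pi diffK raddf0. Qed.

Definition quotient_complex : chain_complex := ChainComplex quot_diffK.
End SubQuotientComplex.

HB.mixin Record isQuandle X := {
  qop : X -> X -> X;
  qopxx : idempotent_op qop;
  qop_bij : forall b, bijective (qop^~ b);
  qopDl : left_distributive qop qop
}.

#[short(type="quandleType")]
HB.structure Definition Quandle := {X of isQuandle X & Choice X}.

Section QuandleComplexes.
Variable X : quandleType.
Implicit Types (n : nat) (e : bool).

(* With entries numbered from 0, [face false x i] omits x_i, and
   [face true x i] moreover replaces x_j by x_j * x_i for each j < i. *)
Definition face n e (x : n.-tuple X) (i : 'I_n) : n.-1.-tuple X :=
  [tuple let y := tnth x (lift i j) in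
         if e && (j < i)%N then qop y (tnth x i) else y | j < n.-1].

(* The entry called x_i in the usual indexing from 1 is entry i - 1 here, so
   its sign is (-1)^(i.+1) and the sum runs over i > 0. *)
Definition rack_diff_gen n (x : n.-tuple X) : {freeg n.-1.-tuple X} :=
  \sum_(i < n | (0 < i)%N)
    (-1) ^+ i.+1 *: (<< face false x i >> - << face true x i >>).

Definition rack_diff n : {freeg n.-tuple X} -> {freeg n.-1.-tuple X} :=
  fglift (@rack_diff_gen n).

HB.instance Definition _ n := GRing.isZmodMorphism.Build _ _ (@rack_diff n)
  (lift_is_additive (@rack_diff_gen n)).

Lemma rack_diffU n (x : n.-tuple X) : rack_diff << x >> = rack_diff_gen x.
Proof. by rewrite /rack_diff liftU scale1r. Qed.

Lemma freeg_eq0 (K : choiceType) (V : zmodType) (f : {additive {freeg K} -> V}) :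
  (forall x, f << x >> = 0) -> forall c, f c = 0.
Proof.
move=> f0 c; rewrite -[c]freeg_sumE raddf_sum big1_seq // => x _.
by rewrite -[coeff x c]intz -freegU_mulz raddfMz f0 mul0rz.
Qed.

Lemma freeg_eqN0 (K : choiceType) (c : {freeg K}) : c = - c -> c = 0.
Proof.
move=> cN; apply/eqP/freeg_eqP => x; rewrite coeff0.
have /eqP := congr1 (coeff x) cN; rewrite coeffN; lia.
Qed.

Lemma face_face n (x : n.+2.-tuple X) e f (j : 'I_n.+2) (i j' : 'I_n.+1)
    (i' : 'I_n.+2) : (i < j)%N -> i' = i :> nat -> j' = j.-1 :> nat ->
  face e (face f x j) i = face f (face e x i') j'.
Proof.
move=> ij i'E j'E; apply: eq_from_tnth => k; rewrite !tnth_mktuple.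
have -> : lift i' (lift j' k) = lift j (lift i k).
  by apply: val_inj => /=; rewrite /bump; lia.
have -> : lift j i = i' by apply: val_inj => /=; rewrite /bump; lia.
have -> : lift i' j' = j by apply: val_inj => /=; rewrite /bump; lia.
have -> : (lift i k < j)%N = (k < j')%N by rewrite /= /bump; lia.
have -> : (lift j' k < i')%N = (k < i)%N by rewrite /= /bump; lia.
have -> : (j' < i')%N = false by lia.
rewrite ij andbF andbT.
have : (k < i)%N -> (k < j')%N by lia.
case: e f (k < i)%N (k < j')%N => [] [] [] [] //= => [_|/(_ isT)//].
by rewrite [RHS]qopDl.
Qed.

Lemma face0 n (x : n.-tuple X) (i : 'I_n) :
  i = 0%N :> nat -> face true x i = face false x i.
Proof.
by move=> i0; apply: eq_from_tnth => k; rewrite !tnth_mktuple i0 ltn0.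
Qed.

Lemma rack_diff_genE n (x : n.-tuple X) :
  rack_diff_gen x = \sum_(i < n) \sum_(e : bool)
    (-1) ^+ (i.+1 + e) *: << face e x i >>.
Proof.
rewrite /rack_diff_gen big_mkcond; apply: eq_bigr => i _.
rewrite big_bool /= [RHS]addrC addn1 addn0 [_ ^+ i.+2]exprS mulN1r scaleNr.
rewrite -scalerBr; case: (posnP i) => [i0|//].
by rewrite (face0 x i0) subrr scaler0.
Qed.

Fact rack_diffK n (c : {freeg n.-tuple X}) : rack_diff (rack_diff c) = 0.
Proof.
apply: (@freeg_eq0 _ _ (@rack_diff n.-1 \o @rack_diff n)) => {c} x /=.
rewrite rack_diffU; case: n x => [|[|n]] x.
- by rewrite rack_diff_genE big_ord0 raddf0.
- by rewrite /rack_diff_gen big1 ?raddf0 // => i; rewrite ord1.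
pose A (p : 'I_n.+2 * 'I_n.+1) : {freeg n.-tuple X} :=
  \sum_(f : bool) \sum_(e : bool)
    (-1) ^+ (p.1 + p.2 + e + f) *: << face e (face f x p.1) p.2 >>.
have -> : rack_diff (rack_diff_gen x) = \sum_p A p.
  rewrite rack_diff_genE raddf_sum -(pair_bigA _ (fun j i => A (j, i))) /=.
  apply: eq_bigr => j _; rewrite raddf_sum exchange_big /=.
  apply: eq_bigr => f _; rewrite -signr_odd scaler_sign -scaler_sign.
  have -> : rack_diff ((-1) ^+ odd (j.+1 + f) *: << face f x j >>) =
      (-1) ^+ odd (j.+1 + f) *: rack_diff << face f x j >>.
    by rewrite !scaler_sign; case: ifP => _; rewrite ?raddfN.
  rewrite rack_diffU rack_diff_genE scaler_sumr; apply: eq_bigr => i _.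
  rewrite scaler_sumr; apply: eq_bigr => e _.
  rewrite signr_odd scalerA -exprD; congr (_ *: _).
  have -> : (j.+1 + f + (i.+1 + e) = (j + i + e + f).+2)%N by lia.
  by rewrite 2!exprS !mulN1r opprK.
pose h (p : 'I_n.+2 * 'I_n.+1) : 'I_n.+2 * 'I_n.+1 :=
  (lift p.1 p.2, inord (if (p.2 < p.1)%N then p.1.-1 else p.1)).
have hE p : (h p).1 = (if (p.2 < p.1)%N then p.2 : nat else p.2.+1) :> nat /\
            (h p).2 = (if (p.2 < p.1)%N then p.1.-1 else p.1 : nat) :> nat.
  case: p => j i /=; rewrite /bump inordK.
    by case: (ltnP i j); lia.
  by have := ltn_ord i; have := ltn_ord j; case: (ltnP i j); lia.
clearbody h.
have hK : involutive h.
  move=> p; have [h1 h2] := hE (h p); have [h3 h4] := hE p.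
  case: (h (h p)) h1 h2 => a b /= h1 h2.
  case: (h p) h1 h2 h3 h4 => c d /=; case: p => j i /=.
  case: (ltnP i j) => ij aE bE cE dE; move: aE bE; rewrite cE dE.
    have -> : (j.-1 < i)%N = false by lia.
    by move=> aE bE; congr (_, _); apply: val_inj; rewrite /= ?aE ?bE; lia.
  have -> : (j < i.+1)%N by lia.
  by move=> aE bE; congr (_, _); apply: val_inj; rewrite /= ?aE ?bE.
have AN p : A (h p) = - A p.
  rewrite /A exchange_big /= -sumrN; apply: eq_bigr => f _.
  rewrite -sumrN; apply: eq_bigr => e _; have [h1 h2] := hE p.
  rewrite -scaleNr; case: (ltnP p.2 p.1) h1 h2 => ij h1 h2.
    have -> : (p.1 + p.2 + e + f = ((h p).1 + (h p).2 + f + e).+1)%N by lia.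
    by rewrite exprS mulN1r opprK (face_face _ _ _ ij h1 h2).
  have -> : ((h p).1 + (h p).2 + f + e = (p.1 + p.2 + e + f).+1)%N by lia.
  by rewrite exprS mulN1r (@face_face _ _ _ _ _ _ p.2 p.1) //; lia.
apply: freeg_eqN0; rewrite -sumrN (reindex_inj (inv_inj hK)) /=.
by apply: eq_bigr => p _; rewrite AN.
Qed.

Definition rack_complex : chain_complex := ChainComplex rack_diffK.

Definition degenerate n (x : n.-tuple X) : bool :=
  [exists i : 'I_n, exists j : 'I_n,
    (j == i.+1 :> nat) && (tnth x i == tnth x j)].

(* [dom c] is the set of tuples with nonzero coefficient in c. *)
Definition degenerate_chain n : {pred {freeg n.-tuple X}} :=
  [pred c | all (@degenerate n) (dom c)].

Fact degenerate_chain_zmod_closed n : zmod_closed (@degenerate_chain n).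
Proof.
split=> [|c d /allP dc /allP dd]; first by rewrite inE dom0.
by apply/allP=> x /domB; rewrite mem_cat => /orP[/dc|/dd].
Qed.

HB.instance Definition _ n :=
  GRing.isZmodClosed.Build {freeg n.-tuple X} (@degenerate_chain n)
    (@degenerate_chain_zmod_closed n).

Lemma degenerate_chainP n (c : {freeg n.-tuple X}) :
  reflect (exists s : seq (int * n.-tuple X), all (@degenerate n) (unzip2 s) /\
             c = \sum_(zx <- s) zx.1 *: << zx.2 >>)
          (c \in @degenerate_chain n).
Proof.
have genD x (z : int) : degenerate x -> z *: << x >> \in @degenerate_chain n.
  by move=> dx; apply/allP=> y /domZ_subset; rewrite domU1 inE => /eqP->.
apply: (iffP idP) => [/allP dc|[s [/allP ds ->]]].
  exists [seq (coeff x c, x) | x <- dom c]; split.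
    by rewrite /unzip2 -map_comp map_id; apply/allP.
  rewrite -[LHS]freeg_sumE [RHS]big_map; apply: eq_bigr => x _ /=.
  by apply/eqP/freeg_eqP => y; rewrite coeffZ !coeffU mul1r.
rewrite big_seq rpred_sum // => zx zxs; apply/genD/ds.
by apply: map_f.
Qed.

Lemma degenerate_diff n (c : {freeg n.-tuple X}) :
  c \in @degenerate_chain n -> rack_diff c \in @degenerate_chain n.-1.
Proof.
move/allP=> dc; rewrite -[c]freeg_sumE raddf_sum big_seq rpred_sum // => x.
move=> /dc /existsP[a /existsP[b /andP[/eqP bE /eqP xab]]].
rewrite -[coeff x c]intz -freegU_mulz raddfMz rpredMz //= rack_diffU.
have ab : b != a by rewrite -val_eqE /= bE; lia.
rewrite rack_diff_genE (bigD1 a) //= (bigD1 b) //= addrA rpredD //.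
  rewrite -big_split big1 ?rpred0 //= => e _.
  have -> : face e x b = face e x a.
    apply: eq_from_tnth => k; rewrite !tnth_mktuple -xab.
    have [ka|ka] := eqVneq (k : nat) a.
      have -> : lift b k = a by apply: val_inj; rewrite /= /bump; lia.
      have -> : lift a k = b by apply: val_inj; rewrite /= /bump; lia.
      by rewrite -xab bE ka leqnn ltnn andbF andbT /= qopxx if_same.
    have -> : lift b k = lift a k by apply: val_inj; rewrite /= /bump; lia.
    by have -> : (k < b)%N = (k < a)%N by lia.
  by rewrite -scalerDl bE [(a.+2 + e)%N]addSn [_ ^+ (a.+1 + e).+1]exprS mulN1r subrr scale0r.
apply: rpred_sum => i /andP[ia ib]; apply: rpred_sum => e _.
suff: << face e x i >> \in @degenerate_chain n.-1.
  by rewrite -signr_odd scaler_sign; case: ifP => // _; rewrite rpredN.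
rewrite inE domU1 /= andbT.
have {}ia : (i : nat) != a by rewrite val_eqE.
have {}ib : (i : nat) != b by rewrite val_eqE.
have la := ltn_ord a; have lb := ltn_ord b; have li := ltn_ord i.
have a'P : ((if (i < a)%N then a.-1 else a) < n.-1)%N by case: ifP; lia.
have b'P : ((if (i < b)%N then b.-1 else b) < n.-1)%N by case: ifP; lia.
apply/existsP; exists (Ordinal a'P); apply/existsP; exists (Ordinal b'P).
rewrite !tnth_mktuple.
have -> : lift i (Ordinal a'P) = a.
  by apply: val_inj; rewrite /= /bump; case: (ltnP i a); lia.
have -> : lift i (Ordinal b'P) = b.
  by apply: val_inj; rewrite /= /bump; case: (ltnP i b); lia.
apply/andP; split; first by rewrite /=; case: (ltnP i a); case: (ltnP i b); lia.
rewrite /= -xab.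
have -> : ((if (i < a)%N then a.-1 else a) < i)%N =
          ((if (i < b)%N then b.-1 else b) < i)%N.
  by case: (ltnP i a); case: (ltnP i b); lia.
by [].
Qed.

Definition degenerate_complex : chain_complex :=
  @subcomplex rack_complex (fun n => @degenerate_chain n) degenerate_diff.

Definition quandle_complex : chain_complex :=
  @quotient_complex rack_complex (fun n => @degenerate_chain n) degenerate_diff.
End QuandleComplexes.

Inductive homology_theory := RackH | QuandleH | DegenerateH.

Definition quandle_homology (W : homology_theory) (X : quandleType) (n : nat) :
    zmodType :=
  homology match W with
           | RackH => rack_complex X
           | QuandleH => quandle_complex X
           | DegenerateH => degenerate_complex X
           end n.

(* For m >= 1 this is Z/m; unlike 'Z_m it is also correct for m = 1. *)
Definition Zmod (m : nat) : zmodType := 'I_m.-1.+1.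

Definition dihedral (m : nat) : Type := 'I_m.-1.+1.

Section Dihedral.
Variable m : nat.
Implicit Types a b c : Zmod m.

HB.instance Definition _ := Finite.on (dihedral m).

Definition dihedral_op a b : Zmod m := b *+ 2 - a.

Fact dihedral_opxx : idempotent_op dihedral_op.
Proof. by move=> a; rewrite /dihedral_op mulr2n addrK. Qed.

Fact dihedral_opK b : involutive (dihedral_op^~ b).
Proof. by move=> a; rewrite /dihedral_op opprB addrC subrK. Qed.

Fact dihedral_op_bij b : bijective (dihedral_op^~ b).
Proof. exact: inv_bij (dihedral_opK b). Qed.

Fact dihedral_opDl : left_distributive dihedral_op dihedral_op.
Proof.
move=> a b c; rewrite /dihedral_op mulrnBl !opprB.
rewrite [in RHS](mulr2n (c *+ 2)) [RHS]addrACA [- _ - _ in RHS]addrC.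
by rewrite [RHS]addrACA addrK.
Qed.

HB.instance Definition _ := isQuandle.Build (dihedral m)
  dihedral_opxx dihedral_op_bij dihedral_opDl.
End Dihedral.

(* Main.v *)
From HB Require Import structures.
Require Import Defs.
From mathcomp Require Import freeg.
From mathcomp Require Import all_boot all_order all_algebra.
From mathcomp Require Import ring_quotient boolp.
From mathcomp Require Import zify ring.

Set Implicit Arguments.
Unset Strict Implicit.
Unset Printing Implicit Defensive.

Import GRing.Theory Num.Theory.
Local Open Scope ring_scope.
Local Open Scope quotient_scope.

(** The two direct sums come from retractions.  When a quandle A is a retract of
    X, its homology is a direct summand of that of X, for each of the three
    theories.

    For coprime m and k, the quandle R_(mk) is the product of R_m and R_k, so
    both factors are retracts of it, and the projection to one factor sends the
    other factor to a point.  The chain groups of a point are torsion free and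
    its differentials vanish, so a map that factors through a point kills every
    torsion class.  The two projections therefore recover a and b from the image
    of a + b, for torsion classes a and b (lemma [embeds_tor_coprime]).

    For k odd, R_(2k) is the union of its even and odd elements; each class is a
    copy of R_k and is stable under the action of R_(2k).  The differential
    never deletes the first entry of a tuple and only moves it inside its class,
    so the chains whose first entry is even form a direct summand of the
    complex, and likewise for odd.  Projecting one summand to R_k and sending
    the other to 0 is a chain map that separates the two copies
    ([embeds_tor_double]).

    The subgroups Z_k come from classes of order k in degrees 3 and 4 of R_k, for
    k odd and greater than 1, which pass to R_(mk) by retraction.  The cycle is
      z = sum_i (0, i, i + 1),  i in Z/k.
    It is torsion: inserting an element y in second position shows that 0 can be
    replaced by any 2 y, so k z is homologous to the sum of the cycles
    sum_i (c, i, i + 1) over all c; after summation over c the action on the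
    first entry is invisible, and the relations coming from the tuples
    (c, t, t + u, t + u + v) kill k times that sum ([polygon_torsion]).
    It is detected by a cocycle of Mochizuki type.  Let tau lift Z/k to
    [0, k) and let the integers g(a, b) measure the failure of tau to preserve
    the operation: tau(a * b) = 2 tau b - tau a + k g(a, b).  Then
    (tau x - tau y) g(y, z) is a cocycle modulo k, whose value on z is -1.  So k
    divides the order of the class of z, and some multiple of that class has
    order exactly k.

    In degree 4 one takes the suspension (w, a) + (w * a, a) of z.  It is a
    chain map because the action of a is an involution, so the suspension of z
    is again a torsion cycle.  The cocycle that detects it is
    (tau x - tau y) (g(y, z) - g(y, w) + g(z, w)), with value k - 2, which is
    prime to the odd number k. *)

(** * Chain maps and the homology maps they induce *)

Lemma piq0 (V : zmodType) (S : zmodClosed V) (v : V) :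
  (\pi_(Quotient.quot S) v == 0) = (v \in S).
Proof.
by rewrite -[RHS]/(_ \in S) -[v in RHS]subr0 Quotient.idealrBE raddf0.
Qed.

Lemma embeds_comp (A B V : zmodType) (g : {additive B -> V}) :
  injective g -> embeds A B -> embeds A V.
Proof. by move=> gI [f fI]; exists (g \o f); apply: inj_comp. Qed.

Section HomologyClass.
Variables (C : chain_complex) (n : nat).

Definition hclass (z : subgroup (@Defs.cycle C n)) : homology C n :=
  \pi_(homology C n) z.

Fact hclass_is_zmod_morphism : zmod_morphism hclass.
Proof. by move=> z t; rewrite /hclass raddfB. Qed.

HB.instance Definition _ := GRing.isZmodMorphism.Build _ _ hclass
  hclass_is_zmod_morphism.

Definition hrepr (x : homology C n) : subgroup (@Defs.cycle C n) := repr x.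

Lemma hreprK : cancel hrepr hclass.
Proof. exact: reprK. Qed.

Lemma hclassP (x : homology C n) : exists z, x = hclass z.
Proof. by exists (hrepr x); rewrite hreprK. Qed.

Lemma hclass0P z : hclass z = 0 <-> exists c, diff C n.+1 c = val z.
Proof.
rewrite /hclass; split=> [/eqP|bz].
  by rewrite piq0 => /asboolP.
by apply/eqP; rewrite piq0; apply/asboolP.
Qed.
End HomologyClass.

Record chain_map (C D : chain_complex) := ChainMap {
  chain_fun :> forall n, {additive C n -> D n};
  chain_funE : forall n (c : C n),
    diff D n (chain_fun n c) = chain_fun n.-1 (diff C n c) }.

Section HomologyMap.
Variables (C D : chain_complex) (f : chain_map C D) (n : nat).

Fact cycle_map_subproof (z : subgroup (@Defs.cycle C n)) :
  f n (val z) \in @Defs.cycle D n.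
Proof. by rewrite inE chain_funE; have /eqP-> := valP z; rewrite raddf0. Qed.

Definition cycle_map z := Subgroup (cycle_map_subproof z).

Definition homology_map (x : homology C n) : homology D n :=
  hclass (cycle_map (hrepr x)).

Lemma homology_mapE z : homology_map (hclass z) = hclass (cycle_map z).
Proof.
apply/eqP; rewrite -subr_eq0 /homology_map -raddfB; apply/eqP/hclass0P.
have /hclass0P[c dc] : hclass (hrepr (hclass z) - z) = 0.
  by apply/eqP; rewrite raddfB subr_eq0 /= hreprK.
by exists (f n.+1 c); rewrite chain_funE /= dc !raddfB.
Qed.

Fact homology_map_is_zmod_morphism : zmod_morphism homology_map.
Proof.
move=> x y; have [z ->] := hclassP x; have [t ->] := hclassP y.
rewrite -raddfB !homology_mapE -raddfB.
by congr hclass; apply: val_inj; rewrite /= !raddfB.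
Qed.

HB.instance Definition _ := GRing.isZmodMorphism.Build _ _ homology_map
  homology_map_is_zmod_morphism.
End HomologyMap.

Section HomologyComposites.
Variables (C D E : chain_complex) (f : chain_map C D) (n : nat).

Lemma homology_map_cancel (g : chain_map D C) :
  cancel (f n) (g n) -> cancel (homology_map f (n:=n)) (homology_map g (n:=n)).
Proof.
move=> fK x; have [z ->] := hclassP x; rewrite !homology_mapE.
by congr hclass; apply: val_inj; rewrite /= fK.
Qed.

Lemma homology_map_comp0 (g : chain_map D E) :
  (forall c, g n (f n c) = 0) ->
  forall x, homology_map g (homology_map f (n:=n) x) = 0.
Proof.
move=> gf0 x; have [z ->] := hclassP x; rewrite !homology_mapE.
by apply/hclass0P; exists 0; rewrite raddf0 /= gf0.
Qed.

(** A composite that vanishes on boundaries sends some multiple of a torsion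
    cycle to 0 on the chain level, hence also the cycle itself when the target
    has no torsion. *)
Lemma homology_map_comp_tor (g : chain_map D E) :
  (forall c : C n.+1, g n (f n (diff C n.+1 c)) = 0) ->
  (forall (e : E n) r, (0 < r)%N -> e *+ r = 0 -> e = 0) ->
  forall x : tor (homology C n),
    homology_map g (homology_map f (n:=n) (val x)) = 0.
Proof.
move=> gfd0 Etf [x /= /asboolP[r r0]]; have [z ->] := hclassP x.
rewrite -raddfMn => /hclass0P[c dc]; rewrite !homology_mapE; apply/hclass0P.
exists 0; rewrite raddf0; apply/esym/(Etf _ r) => //=.
by rewrite -[RHS](gfd0 c) dc !raddfMn.
Qed.
End HomologyComposites.

(** * Maps of rack complexes in the three theories *)

Section SubQuotientMaps.
Variables (C D : chain_complex).
Variables (S : forall n, zmodClosed (C n)) (T : forall n, zmodClosed (D n)).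
Hypothesis diffS : forall n (c : C n), c \in S n -> diff C n c \in S n.-1.
Hypothesis diffT : forall n (c : D n), c \in T n -> diff D n c \in T n.-1.
Variables (f : chain_map C D) (fS : forall n c, c \in S n -> f n c \in T n).

Definition sub_fun n (c : subgroup (S n)) : subgroup (T n) :=
  Subgroup (fS (valP c)).

Fact sub_fun_is_zmod_morphism n : zmod_morphism (@sub_fun n).
Proof. by move=> u v; apply: val_inj; rewrite /= !raddfB. Qed.

HB.instance Definition _ n := GRing.isZmodMorphism.Build _ _ (@sub_fun n)
  (@sub_fun_is_zmod_morphism n).

Fact sub_funE n (c : subcomplex diffS n) :
  diff (subcomplex diffT) n (sub_fun c) = sub_fun (diff (subcomplex diffS) n c).
Proof. by apply: val_inj; rewrite /= chain_funE. Qed.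

Definition sub_map : chain_map (subcomplex diffS) (subcomplex diffT) :=
  ChainMap sub_funE.

Definition quot_fun n (c : Quotient.quot (S n)) : Quotient.quot (T n) :=
  \pi_(Quotient.quot (T n)) (f n (repr c)).

Lemma quot_fun_pi n (c : C n) :
  quot_fun (\pi_(Quotient.quot (S n)) c) = \pi_(Quotient.quot (T n)) (f n c).
Proof.
apply/eqP; rewrite /quot_fun -Quotient.idealrBE -raddfB; apply: fS.
by rewrite Quotient.idealrBE reprK.
Qed.

Fact quot_fun_is_zmod_morphism n : zmod_morphism (@quot_fun n).
Proof.
move=> u v; rewrite -[u]reprK -[v]reprK -raddfB !quot_fun_pi.
by rewrite -!raddfB.
Qed.

HB.instance Definition _ n := GRing.isZmodMorphism.Build _ _ (@quot_fun n)
  (@quot_fun_is_zmod_morphism n).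

Fact quot_funE n (c : quotient_complex diffS n) :
  diff (quotient_complex diffT) n (quot_fun c) =
  quot_fun (diff (quotient_complex diffS) n c).
Proof.
rewrite -[c]reprK quot_fun_pi /= (quot_diff_pi diffT) (quot_diff_pi diffS).
by rewrite quot_fun_pi chain_funE.
Qed.

Definition quot_map :
    chain_map (quotient_complex diffS) (quotient_complex diffT) :=
  ChainMap quot_funE.
End SubQuotientMaps.

Section QuandleChainClass.
Variables (X : quandleType) (n : nat).

Definition qclass (c : {freeg n.-tuple X}) : quandle_complex X n :=
  \pi_(Quotient.quot (@degenerate_chain X n)) c.

Fact qclass_is_zmod_morphism : zmod_morphism qclass.
Proof. by move=> c d; rewrite /qclass raddfB. Qed.

HB.instance Definition _ := GRing.isZmodMorphism.Build _ _ qclass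
  qclass_is_zmod_morphism.

Lemma qclassP (x : quandle_complex X n) : exists c, x = qclass c.
Proof. by exists (repr x); apply/esym/reprK. Qed.

Lemma qclass_eq0 c : (qclass c == 0) = (c \in @degenerate_chain X n).
Proof. exact: piq0. Qed.

Lemma diff_qclass c :
  diff (quandle_complex X) n (qclass c) =
  \pi_(Quotient.quot (@degenerate_chain X n.-1)) (rack_diff c).
Proof. exact: (@quot_diff_pi (rack_complex X) (fun n => @degenerate_chain X n)
  (@degenerate_diff X)). Qed.
End QuandleChainClass.

Definition theory_complex W (X : quandleType) : chain_complex :=
  match W with
  | RackH => rack_complex X
  | QuandleH => quandle_complex X
  | DegenerateH => degenerate_complex X
  end.

Section TheoryMap.
Variables (X Y : quandleType).

Definition preserves_degenerate
    (f : chain_map (rack_complex X) (rack_complex Y)) :=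
  forall n c, c \in @degenerate_chain X n -> f n c \in @degenerate_chain Y n.

Definition theory_map W f (fD : preserves_degenerate f) :
    chain_map (theory_complex W X) (theory_complex W Y) :=
  match W return chain_map (theory_complex W X) (theory_complex W Y) with
  | RackH => f
  | QuandleH => @quot_map (rack_complex X) (rack_complex Y)
      (fun n => @degenerate_chain X n) (fun n => @degenerate_chain Y n)
      (@degenerate_diff X) (@degenerate_diff Y) f fD
  | DegenerateH => @sub_map (rack_complex X) (rack_complex Y)
      (fun n => @degenerate_chain X n) (fun n => @degenerate_chain Y n)
      (@degenerate_diff X) (@degenerate_diff Y) f fD
  end.

Lemma theory_map_qclass f (fD : preserves_degenerate f) n
    (c : {freeg n.-tuple X}) :
  theory_map QuandleH fD n (qclass c) = qclass (f n c).
Proof.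
exact: (@quot_fun_pi (rack_complex X) (rack_complex Y)
      (fun n => @degenerate_chain X n) (fun n => @degenerate_chain Y n) f fD).
Qed.
End TheoryMap.
Arguments theory_map {X Y} W [f] fD.

Section TheoryComposites.
Variables (W : homology_theory) (X Y Z : quandleType) (n : nat).
Variables (f : chain_map (rack_complex X) (rack_complex Y)).
Hypothesis fD : preserves_degenerate f.

Lemma theory_map_cancel (g : chain_map (rack_complex Y) (rack_complex X))
    (gD : preserves_degenerate g) :
  cancel (f n) (g n) -> cancel (theory_map W fD n) (theory_map W gD n).
Proof.
move=> fK; case: W => c; first exact: fK.
  by have [d ->] := qclassP c; rewrite !theory_map_qclass fK.
by apply: val_inj => /=; rewrite fK.
Qed.

Variables (g : chain_map (rack_complex Y) (rack_complex Z)).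
Hypothesis gD : preserves_degenerate g.

Lemma theory_map_comp0 :
  (forall c, g n (f n c) = 0) ->
  forall c, theory_map W gD n (theory_map W fD n c) = 0.
Proof.
move=> gf0; case: W => c; first exact: gf0.
  by have [d ->] := qclassP c; rewrite !theory_map_qclass gf0 raddf0.
by apply: val_inj => /=; rewrite gf0.
Qed.

Lemma theory_map_comp_diff0 :
  (forall c : {freeg n.+1.-tuple X}, g n (f n (rack_diff c)) = 0) ->
  forall c : theory_complex W X n.+1,
    theory_map W gD n
      (theory_map W fD n (diff (theory_complex W X) n.+1 c)) = 0.
Proof.
move=> gf0; case: W => c; first exact: gf0.
  have [d ->] := qclassP c; rewrite diff_qclass.
  by rewrite -/(@qclass X n _) !theory_map_qclass gf0 raddf0.
by apply: val_inj => /=; rewrite gf0.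
Qed.
End TheoryComposites.

Lemma dom_mulrn (K : choiceType) (c : {freeg K}) r :
  (0 < r)%N -> dom (c *+ r) =i dom c.
Proof.
by move=> r0 x; rewrite !mem_dom coeffMn mulrn_eq0 eqn0Ngt r0.
Qed.

(** The quandle chain groups have no torsion because degenerate tuples are part
    of the basis: a multiple of a chain involves the same tuples as the chain. *)
Lemma theory_chains_torsion_free W (X : quandleType) n
    (c : theory_complex W X n) r :
  (0 < r)%N -> c *+ r = 0 -> c = 0.
Proof.
move=> r0; have freeg_tf (e : {freeg n.-tuple X}) : e *+ r = 0 -> e = 0.
  move=> er; apply/eqP/freeg_eqP => x; have /eqP := congr1 (coeff x) er.
  by rewrite coeffMn coeff0 mulrn_eq0 eqn0Ngt r0 => /eqP.
case: W c => c; first exact: freeg_tf.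
  have [d ->] := qclassP c; rewrite -raddfMn => /eqP.
  rewrite qclass_eq0 => /allP cr; apply/eqP.
  by rewrite qclass_eq0; apply/allP=> x; rewrite -(dom_mulrn _ r0) => /cr.
by move=> /(congr1 val); rewrite raddfMn raddf0 => /freeg_tf c0; apply: val_inj.
Qed.

(** * Chain maps supported on tuples starting in a union of orbits *)

Lemma freeg_ext (K : choiceType) (V : zmodType)
    (f g : {additive {freeg K} -> V}) :
  (forall x, f << x >> = g << x >>) -> f =1 g.
Proof.
move=> fg c; apply/eqP; rewrite -subr_eq0; apply/eqP.
by apply: (@freeg_eq0 _ _ (f \- g)) => x /=; rewrite fg subrr.
Qed.

Section OrbitMap.
Variables (X Y : quandleType) (P : pred X) (p : X -> Y).
Hypothesis P_qop : forall a b, P (qop a b) = P a.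
Hypothesis p_qop : {morph p : a b / qop a b}.

(** [take 1] makes the condition on the first entry meaningful for the empty
    tuple too.  With [P] true everywhere this is the map induced by [p]. *)
Definition orbit_map_gen n (x : n.-tuple X) : {freeg n.-tuple Y} :=
  if all P (take 1 x) then << map_tuple p x >> else 0.

Definition orbit_map_fun n : {freeg n.-tuple X} -> {freeg n.-tuple Y} :=
  fglift (@orbit_map_gen n).

HB.instance Definition _ n := GRing.isZmodMorphism.Build _ _ (@orbit_map_fun n)
  (lift_is_additive (@orbit_map_gen n)).

Lemma orbit_map_funU n (x : n.-tuple X) :
  orbit_map_fun << x >> = if all P (take 1 x) then << map_tuple p x >> else 0.
Proof. by rewrite /orbit_map_fun liftU scale1r. Qed.

Lemma face_map n e (x : n.-tuple X) (i : 'I_n) :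
  face e (map_tuple p x) i = map_tuple p (face e x i).
Proof.
apply: eq_from_tnth => j; rewrite !(tnth_mktuple, tnth_map) /=.
by rewrite [RHS]fun_if p_qop.
Qed.

Lemma all_take1 n (x : n.+1.-tuple X) : all P (take 1 x) = P (tnth x ord0).
Proof. by case/tupleP: x => a t; rewrite /= take0 andbT tnth0. Qed.

Lemma all_take1_face n e (x : n.-tuple X) (i : 'I_n) :
  (0 < i)%N -> all P (take 1 (face e x i)) = all P (take 1 x).
Proof.
case: n x i => [|[|n]] x i i0; [by case: i i0|by rewrite ord1 in i0|].
rewrite !all_take1 tnth_mktuple /=.
have -> : lift i ord0 = ord0 by apply: val_inj; rewrite /= /bump leqNgt i0.
by rewrite fun_if P_qop if_same.
Qed.

(** The sum defining the differential starts at the second entry, so faces keep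
    the first entry up to the action, under which [P] is invariant. *)
Lemma rack_diff_orbit_map n (c : {freeg n.-tuple X}) :
  rack_diff (orbit_map_fun c) = orbit_map_fun (rack_diff c).
Proof.
apply: (freeg_ext (f := @rack_diff Y n \o @orbit_map_fun n)
                  (g := @orbit_map_fun n.-1 \o @rack_diff X n)) => {c} x /=.
rewrite orbit_map_funU rack_diffU raddf_sum.
have termE (i : 'I_n) : (0 < i)%N ->
    orbit_map_fun
      ((-1) ^+ i.+1 *: (<< face false x i >> - << face true x i >>)) =
    if all P (take 1 x) then (-1) ^+ i.+1 *:
      (<< face false (map_tuple p x) i >> - << face true (map_tuple p x) i >>)
    else 0.
  move=> i0; rewrite -signr_odd !scaler_sign !face_map.
  have faceE e : orbit_map_fun << face e x i >> =
      if all P (take 1 x) then << map_tuple p (face e x i) >> else 0.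
    by rewrite orbit_map_funU all_take1_face.
  by case: (odd _); rewrite ?raddfN raddfB /= !faceE; case: ifP;
    rewrite ?subrr ?oppr0.
rewrite (eq_bigr _ termE); case: ifP => _; first by rewrite rack_diffU.
by rewrite raddf0 big1.
Qed.

Definition orbit_map : chain_map (rack_complex X) (rack_complex Y) :=
  @ChainMap (rack_complex X) (rack_complex Y) (fun n => @orbit_map_fun n)
    rack_diff_orbit_map.

Lemma orbit_map_degenerate : preserves_degenerate orbit_map.
Proof.
move=> n c /allP dc /=; rewrite -[c]freeg_sumE raddf_sum big_seq.
rewrite rpred_sum // => x /dc /existsP[i /existsP[j /andP[ij /eqP xij]]].
rewrite -[coeff x c]intz -freegU_mulz raddfMz rpredMz //= orbit_map_funU.
case: ifP => _; last exact: rpred0.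
rewrite inE domU1 /= andbT; apply/existsP; exists i; apply/existsP; exists j.
by rewrite ij !tnth_map xij eqxx.
Qed.
End OrbitMap.

Section OrbitMapComposition.
Variables (X Y Z : quandleType) (i : X -> Y) (P : pred Y) (p : Y -> Z).
Variable n : nat.

Lemma orbit_map_fun_comp (c : {freeg n.-tuple X}) :
  orbit_map_fun P p (orbit_map_fun predT i c) =
  orbit_map_fun (P \o i) (p \o i) c.
Proof.
apply: (freeg_ext
  (f := @orbit_map_fun _ _ P p n \o @orbit_map_fun _ _ predT i n)) => x /=.
rewrite !orbit_map_funU all_predT orbit_map_funU -map_take all_map.
by congr (if _ then << _ >> else _); apply: val_inj; rewrite /= map_comp.
Qed.
End OrbitMapComposition.

Section OrbitMapSpecial.
Variables (X Y : quandleType) (n : nat).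

Lemma orbit_map_fun_id (P : pred X) (p : X -> X) (c : {freeg n.-tuple X}) :
  P =1 predT -> p =1 id -> orbit_map_fun P p c = c.
Proof.
move=> PT pI; apply: (freeg_ext (g := idfun)) => x /=.
rewrite orbit_map_funU (eq_all PT) all_predT; congr << _ >>.
by apply: val_inj; rewrite /= (eq_map pI) map_id.
Qed.

Lemma orbit_map_fun_pred0 (P : pred X) (p : X -> Y)
    (c : {freeg n.+1.-tuple X}) :
  P =1 pred0 -> orbit_map_fun P p c = 0.
Proof.
move=> P0; apply: (@freeg_eq0 _ _ (@orbit_map_fun X Y P p n.+1)) => x /=.
by rewrite orbit_map_funU all_take1 P0.
Qed.

(** A constant map identifies the two faces that the differential subtracts at
    each entry. *)
Lemma const_orbit_map_diff (P : pred X) (p : X -> Y)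
    (c : {freeg n.+1.-tuple X}) :
  P =1 predT -> (forall a b, p a = p b) -> orbit_map_fun P p (rack_diff c) = 0.
Proof.
move=> PT pC; apply: (@freeg_eq0 _ _
  (@orbit_map_fun X Y P p n.+1.-1 \o @rack_diff X n.+1)) => x /=.
rewrite rack_diffU raddf_sum big1 // => i _; rewrite -signr_odd scaler_sign.
suff pd0: orbit_map_fun P p (<< face false x i >> - << face true x i >>) = 0.
  by case: ifP => _; rewrite ?raddfN /= pd0 ?oppr0.
rewrite raddfB /= !orbit_map_funU !(eq_all PT) !all_predT.
rewrite (_ : map_tuple p (face true x i) = map_tuple p (face false x i)).
  exact: subrr.
by apply: eq_from_tnth => j; rewrite !tnth_map; apply: pC.
Qed.
End OrbitMapSpecial.

(** * Homology of quandle retracts *)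

Lemma embeds_sum (A B A' B' V : zmodType)
    (fA : {additive A -> V}) (fB : {additive B -> V})
    (gA : {additive V -> A'}) (gB : {additive V -> B'}) :
  injective (gA \o fA) -> injective (gB \o fB) ->
  (forall b, gA (fB b) = 0) -> (forall a, gB (fA a) = 0) ->
  embeds (A * B)%type V.
Proof.
move=> gfA gfB gfAB gfBA; pose h (u : A * B) := fA u.1 + fB u.2.
have hM : zmod_morphism h by move=> u v; rewrite /h !raddfB opprD addrACA.
pose hA : {additive (A * B)%type -> V} :=
  HB.pack h (GRing.isZmodMorphism.Build _ _ h hM).
exists hA; apply: raddf_inj => -[a b]; rewrite /= /h /= => ab0.
congr (_, _).
  by apply: gfA; rewrite /= !raddf0 -[LHS]addr0 -(gfAB b) -raddfD ab0 raddf0.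
by apply: gfB; rewrite /= !raddf0 -[LHS]add0r -(gfBA a) -raddfD ab0 raddf0.
Qed.

(** [support] is a union of orbits containing the image of the inclusion; the
    chain map back to [A] projects the tuples that start in it and discards the
    others.  Disjoint supports separate retracts whose projections agree. *)
Record retract (X A : quandleType) := Retract {
  incl : A -> X;
  proj : X -> A;
  support : pred X;
  incl_qop : {morph incl : a b / qop a b};
  proj_qop : {morph proj : a b / qop a b};
  support_qop : forall a b, support (qop a b) = support a;
  inclK : cancel incl proj;
  incl_support : forall a, support (incl a) }.

Section QuandleRetracts.
Variables (W : homology_theory) (X A : quandleType) (r : retract X A).

Definition incl_map n :
    {additive quandle_homology W A n -> quandle_homology W X n} :=
  @homology_map _ _ (theory_map W (@orbit_map_degenerate A X predT (incl r)
    (fun _ _ => erefl) (incl_qop r))) n.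

Definition proj_map n :
    {additive quandle_homology W X n -> quandle_homology W A n} :=
  @homology_map _ _ (theory_map W (@orbit_map_degenerate X A (support r)
    (proj r) (support_qop r) (proj_qop r))) n.

Lemma incl_mapK n : cancel (@incl_map n) (@proj_map n).
Proof.
apply: homology_map_cancel; apply: theory_map_cancel => c /=.
rewrite orbit_map_fun_comp orbit_map_fun_id // => a /=.
  exact: incl_support.
exact: inclK.
Qed.
End QuandleRetracts.

Section TwoRetracts.
Variables (W : homology_theory) (X A B : quandleType) (n : nat).

(** The composite factors through a point, whose homology is torsion free. *)
Lemma proj_incl_tor (rA : retract X A) (rB : retract X B) :
  (forall x, support rA x) ->
  (forall b c, proj rA (incl rB b) = proj rA (incl rB c)) ->
  forall y : tor (quandle_homology W B n),
    proj_map W rA n (incl_map W rB n (val y)) = 0.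
Proof.
move=> sT pC; apply: homology_map_comp_tor.
  apply: theory_map_comp_diff0 => c /=.
  by rewrite orbit_map_fun_comp const_orbit_map_diff // => b; apply: sT.
exact: theory_chains_torsion_free.
Qed.

Lemma proj_incl_disjoint (rA : retract X A) (rB : retract X B) :
  (forall b, ~~ support rA (incl rB b)) ->
  forall y, proj_map W rA n.+1 (incl_map W rB n.+1 y) = 0.
Proof.
move=> s0; apply: homology_map_comp0; apply: theory_map_comp0 => c /=.
by rewrite orbit_map_fun_comp orbit_map_fun_pred0 // => b; apply/negbTE/s0.
Qed.

Lemma embeds_tor_sum (rA : retract X A) (rB : retract X B) :
  (forall y : tor (quandle_homology W B n),
     proj_map W rA n (incl_map W rB n (val y)) = 0) ->
  (forall y : tor (quandle_homology W A n),
     proj_map W rB n (incl_map W rA n (val y)) = 0) ->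
  embeds (tor (quandle_homology W A n) * tor (quandle_homology W B n))%type
         (quandle_homology W X n).
Proof.
move=> AB BA.
apply: (@embeds_sum _ _ _ _ _ (incl_map W rA n \o val) (incl_map W rB n \o val)
          (proj_map W rA n) (proj_map W rB n)) => //.
  by move=> y z /=; rewrite !incl_mapK; apply: val_inj.
by move=> y z /=; rewrite !incl_mapK; apply: val_inj.
Qed.
End TwoRetracts.

(** * Retracts between dihedral quandles *)

Lemma ltn_Zmod N (x : Zmod N) : (0 < N)%N -> (x < N)%N.
Proof.
by move=> N0; have := ltn_ord x; rewrite [X in (_ < X)%N](prednK N0).
Qed.

Lemma val_inZmod N (x : nat) :
  (0 < N)%N -> (inZp x : Zmod N) = (x %% N)%N :> nat.
Proof. by move=> N0; congr modn; apply: prednK. Qed.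

Lemma val_ZmodD N (x y : Zmod N) :
  (0 < N)%N -> (x + y)%R = ((x + y) %% N)%N :> nat.
Proof. by move=> N0; congr modn; apply: prednK. Qed.

Section ZmodScale.
Variables M N e : nat.
Hypotheses (M0 : (0 < M)%N) (N0 : (0 < N)%N) (NMe : (N %| M * e)%N).

Definition zscale (x : Zmod M) : Zmod N := inZp (x * e).

Lemma val_zscale x : zscale x = (x * e %% N)%N :> nat.
Proof. exact: val_inZmod. Qed.

Lemma zscaleD x y : zscale (x + y) = zscale x + zscale y.
Proof.
have [q qE] := dvdnP NMe.
apply: ord_inj; rewrite [RHS]val_ZmodD // [LHS]val_zscale val_ZmodD //.
rewrite !val_zscale modnDm -mulnDl.
by rewrite [in RHS](divn_eq (x + y) M) mulnDl -mulnA qE mulnA modnMDl.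
Qed.

Fact zscale_is_zmod_morphism : zmod_morphism zscale.
Proof. by move=> x y; apply/eqP; rewrite eq_sym subr_eq -zscaleD subrK. Qed.

Lemma zscale_qop (t : Zmod N) :
  {morph (fun x : dihedral M => zscale x + t : dihedral N) : a b / qop a b}.
Proof.
move=> a b; rewrite /qop /= /dihedral_op zscale_is_zmod_morphism mulr2n zscaleD.
rewrite mulrnDl opprD addrACA; congr (_ + _); rewrite mulr2n addrK //.
Qed.
End ZmodScale.

Section DihedralRetract.
Variables (M N e : nat) (t : Zmod N) (P : pred (dihedral N)).
Hypotheses (M0 : (0 < M)%N) (N0 : (0 < N)%N).
Hypotheses (MN : (M %| N)%N) (NMe : (N %| M * e)%N).
Hypothesis e1 : (e %% M)%N = (1 %% M)%N.
Hypothesis tM : (M %| t)%N.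
Hypothesis P_qop : forall a b, P (qop a b) = P a.
Hypothesis Pe : forall a : Zmod M, P (zscale N e a + t).

Let MN1 : (M %| N * 1)%N. Proof. by rewrite muln1. Qed.

(** An idempotent e splits the reduction Z/N -> Z/M.  Dihedral quandles see only
    affine structure, so the section may also be translated by an element t that
    reduces to 0; distinct t give distinct copies of R_M. *)
Definition dihedral_retract : retract (dihedral N) (dihedral M).
Proof.
apply: (@Retract (dihedral N) (dihedral M) (fun a => zscale N e a + t)
          (fun x => zscale M 1 x + 0) P) => //.
- exact: zscale_qop.
- exact: zscale_qop.
- move=> a; rewrite addr0 zscaleD // [zscale M 1 t](_ : _ = 0); last first.
    by apply: ord_inj; rewrite val_zscale // muln1; apply/eqP.
  rewrite addr0; apply: ord_inj; rewrite !val_zscale // muln1 modn_dvdm //.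
  by rewrite -modnMmr e1 modnMmr muln1 modn_small // ltn_Zmod.
Defined.

Lemma proj_dihedral_retractE x : proj dihedral_retract x = zscale M 1 x.
Proof. by rewrite /= addr0. Qed.
End DihedralRetract.

Section Coprime.
Variables (m k N : nat).
Hypotheses (m0 : (0 < m)%N) (k0 : (0 < k)%N) (mk : coprime m k).
(* A variable for the product: the roles of m and k can then be exchanged
   without changing the type of the ambient quandle. *)
Hypothesis NE : N = (m * k)%N.

Let N0 : (0 < N)%N. Proof. by rewrite NE muln_gt0 m0. Qed.
Let mN : (m %| N)%N. Proof. by rewrite NE dvdn_mulr. Qed.
Let e := chinese m k 1 0.
Let e1 : (e %% m)%N = (1 %% m)%N. Proof. exact: chinese_modl. Qed.
Let ke : (k %| e)%N.
Proof. by rewrite /dvdn [(_ %% _)%N]chinese_modr ?mod0n. Qed.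
Let Nme : (N %| m * e)%N. Proof. by rewrite NE dvdn_pmul2l. Qed.

Definition coprime_retract : retract (dihedral N) (dihedral m) :=
  @dihedral_retract m N e 0 predT m0 N0 mN Nme e1
    (dvdn0 m) (fun _ _ => erefl) (fun _ => erefl).

Lemma incl_coprime_retractE a : incl coprime_retract a = zscale N e a.
Proof. by rewrite /= addr0. Qed.

Lemma zscale_incl_coprime a : zscale k 1 (incl coprime_retract a) = 0.
Proof.
have kN : (k %| N)%N by rewrite NE dvdn_mull.
apply: ord_inj; rewrite incl_coprime_retractE !val_zscale // muln1 modn_dvdm //.
by apply/eqP; rewrite -/(_ %| _)%N dvdn_mull.
Qed.
End Coprime.

Lemma Zmod_coprime_product m k : (0 < m)%N -> (0 < k)%N -> coprime m k ->
  isomorphic (Zmod (m * k)) (Zmod m * Zmod k)%type.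
Proof.
move=> m0 k0 mk; have N0 : (0 < m * k)%N by rewrite muln_gt0 m0.
have mN : (m %| m * k * 1)%N by rewrite muln1 dvdn_mulr.
have kN : (k %| m * k * 1)%N by rewrite muln1 dvdn_mull.
pose f (x : Zmod (m * k)) : Zmod m * Zmod k := (zscale m 1 x, zscale k 1 x).
have fM : zmod_morphism f.
  by move=> x y; rewrite /f !zscale_is_zmod_morphism.
pose fA : {additive Zmod (m * k) -> (Zmod m * Zmod k)%type} :=
  HB.pack f (GRing.isZmodMorphism.Build _ _ f fM).
exists fA.
have fD x y : f (x + y) =
    (zscale m 1 x + zscale m 1 y, zscale k 1 x + zscale k 1 y).
  by rewrite /f !zscaleD.
have km : coprime k m by rewrite coprime_sym.
pose rm := coprime_retract m0 k0 mk (erefl (m * k)%N).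
pose rk := coprime_retract k0 m0 km (mulnC m k).
pose g (u : Zmod m * Zmod k) : Zmod (m * k) := incl rm u.1 + incl rk u.2.
have gK : cancel g f.
  move=> [a b]; rewrite (fD (incl rm a) (incl rk b)).
  have -> : zscale k 1 (incl rm a) = 0 by apply: zscale_incl_coprime.
  have -> : zscale m 1 (incl rk b) = 0 by apply: zscale_incl_coprime.
  rewrite add0r addr0; congr (_, _).
    by rewrite -[RHS](inclK rm) proj_dihedral_retractE.
  by rewrite -[RHS](inclK rk) proj_dihedral_retractE.
have fI : injective f.
  move=> x y fxy; apply: ord_inj.
  have := congr1 (fun u : Zmod m * Zmod k => nat_of_ord u.1) fxy.
  have := congr1 (fun u : Zmod m * Zmod k => nat_of_ord u.2) fxy.
  rewrite /f [fst _]/= !val_zscale // !muln1 => xyk xym.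
  have: ((x : nat) %% (m * k) == y %% (m * k))%N.
    by rewrite chinese_remainder // xym xyk !eqxx.
  by rewrite !modn_small ?ltn_Zmod // => /eqP.
exact: Bijective (inj_can_sym gK fI) gK.
Qed.

Theorem embeds_tor_coprime W m k n :
  (0 < m)%N -> (0 < k)%N -> coprime m k ->
  embeds (tor (quandle_homology W (dihedral m) n) *
          tor (quandle_homology W (dihedral k) n))%type
         (quandle_homology W (dihedral (m * k)) n).
Proof.
move=> m0 k0 mk; have km : coprime k m by rewrite coprime_sym.
apply: (@embeds_tor_sum W _ _ _ n (coprime_retract m0 k0 mk (erefl (m * k)%N))
  (coprime_retract k0 m0 km (mulnC m k))); apply: proj_incl_tor => // a b;
  by rewrite !proj_dihedral_retractE !zscale_incl_coprime //; apply: mulnC.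
Qed.

Section OddDouble.
Variable k : nat.
Hypothesis k_odd : odd k.

Let k0 : (0 < k)%N. Proof. exact: odd_gt0. Qed.
Let k20 : (0 < 2 * k)%N. Proof. by rewrite muln_gt0. Qed.

Definition parity (x : dihedral (2 * k)) : bool := odd x.

Lemma parityD (x y : Zmod (2 * k)) : parity (x + y) = parity x (+) parity y.
Proof.
by rewrite /parity val_ZmodD // odd_mod; [exact: oddD | rewrite oddM].
Qed.

Lemma parity_qop a b : parity (qop a b) = parity a.
Proof.
have : parity (qop a b + a) = false.
  by rewrite /qop /= /dihedral_op subrK mulr2n parityD addbb.
by rewrite parityD; case: (parity _) (parity a) => [] [].
Qed.

Definition coset_shift (b : bool) : Zmod (2 * k) := inZp (b * k).

Lemma val_coset_shift b : coset_shift b = (b * k)%N :> nat.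
Proof. by rewrite val_inZmod // modn_small // ltn_pmul2r //; case: b. Qed.

Lemma parity_coset b (a : Zmod k) :
  parity (zscale (2 * k) k.+1 a + coset_shift b) = b.
Proof.
rewrite parityD /parity val_coset_shift val_zscale // odd_mod.
  by rewrite !oddM /= k_odd andbF andbT; case: b.
by rewrite oddM.
Qed.

(** Multiplication by k + 1, which is even and is 1 modulo k, maps R_k to the
    even elements; adding k maps it to the odd ones. *)
Definition coset_retract (b : bool) : retract (dihedral (2 * k)) (dihedral k).
Proof.
apply: (@dihedral_retract k (2 * k) k.+1 (coset_shift b)
          (fun x => parity x == b)) => //.
- exact: dvdn_mull.
- by rewrite [(2 * k)%N]mulnC dvdn_pmul2l // dvdn2 /= k_odd.
- by rewrite -addn1 modnDl.
- by rewrite val_coset_shift dvdn_mull.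
- by move=> x y; rewrite parity_qop.
- by move=> a; rewrite parity_coset.
Defined.
End OddDouble.

Theorem embeds_tor_double W k n : odd k ->
  embeds (tor (quandle_homology W (dihedral k) n.+1) *
          tor (quandle_homology W (dihedral k) n.+1))%type
         (quandle_homology W (dihedral (2 * k)) n.+1).
Proof.
move=> k_odd.
apply: (@embeds_tor_sum W _ _ _ n.+1
  (coset_retract k_odd false) (coset_retract k_odd true)) => y;
  by apply: proj_incl_disjoint => b; rewrite /= parity_coset.
Qed.

(** * Boundaries in low degrees *)

Section SmallBoundaries.
Variable X : quandleType.
Implicit Types a b c d : X.

Lemma val_face n e (x : n.-tuple X) (i : 'I_n) :
  face e x i = map (fun y => if e then qop y (tnth x i) else y) (take i x)
               ++ drop i.+1 x :> seq X.
Proof.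
have in_ := ltn_ord i.
have a := tnth x i.
have szt : size (take i x) = i by rewrite size_takel // size_tuple ltnW.
apply: (@eq_from_nth _ a) => [|j].
  by rewrite size_tuple size_cat size_map szt size_drop size_tuple; lia.
rewrite size_tuple => jn; rewrite -(tnth_nth a _ (Ordinal jn)) tnth_mktuple /=.
rewrite nth_cat size_map szt !(tnth_nth a x (lift _ _)) /= /bump.
case: (ltnP j i) => ji.
  by rewrite (nth_map a) ?szt // nth_take // andbT add0n.
by rewrite andbF nth_drop; congr nth; lia.
Qed.

Lemma faceP n e (x : n.-tuple X) (i : 'I_n) (y : n.-1.-tuple X) :
  map (fun z => if e then qop z (tnth x i) else z) (take i x) ++ drop i.+1 x
    = y :> seq X ->
  face e x i = y.
Proof. by move=> fxy; apply: val_inj; rewrite /= val_face. Qed.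

Lemma rack_diff3 a b c :
  rack_diff << [tuple a; b; c] >> =
    (<< [tuple a; c] >> - << [tuple qop a b; c] >>)
    - (<< [tuple a; b] >> - << [tuple qop a c; qop b c] >>).
Proof.
rewrite rack_diffU /rack_diff_gen big_mkcond !big_ord_recl big_ord0 /= add0r.
rewrite addr0 /bump /= !exprS expr0 mulr1 !mulN1r !opprK.
rewrite !scaleN1r ?scale1r ?addrA.
by congr (<< _ >> - << _ >> - (<< _ >> - << _ >>)); apply: (@faceP 3).
Qed.

Lemma rack_diff4 a b c d :
  rack_diff << [tuple a; b; c; d] >> =
    (<< [tuple a; c; d] >> - << [tuple qop a b; c; d] >>)
    - (<< [tuple a; b; d] >> - << [tuple qop a c; qop b c; d] >>)
    + (<< [tuple a; b; c] >> - << [tuple qop a d; qop b d; qop c d] >>).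
Proof.
rewrite rack_diffU /rack_diff_gen big_mkcond !big_ord_recl big_ord0 /= add0r.
rewrite addr0 /bump /= !exprS expr0 mulr1 !mulN1r !opprK.
rewrite !scaleN1r ?scale1r ?addrA.
by congr (<< _ >> - << _ >> - (<< _ >> - << _ >>) + << _ >> - << _ >>);
  apply: (@faceP 4).
Qed.

Lemma rack_diff5 a b c d f :
  rack_diff << [tuple a; b; c; d; f] >> =
    (<< [tuple a; c; d; f] >> - << [tuple qop a b; c; d; f] >>)
    - (<< [tuple a; b; d; f] >> - << [tuple qop a c; qop b c; d; f] >>)
    + (<< [tuple a; b; c; f] >> - << [tuple qop a d; qop b d; qop c d; f] >>)
    - (<< [tuple a; b; c; d] >>
       - << [tuple qop a f; qop b f; qop c f; qop d f] >>).
Proof.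
rewrite rack_diffU /rack_diff_gen big_mkcond !big_ord_recl big_ord0 /= add0r.
rewrite addr0 /bump /= !exprS expr0 mulr1 !mulN1r !opprK.
rewrite !scaleN1r ?scale1r ?addrA.
by congr (<< _ >> - << _ >> - (<< _ >> - << _ >>) + << _ >> - << _ >>
  - (<< _ >> - << _ >>)); apply: (@faceP 5).
Qed.

End SmallBoundaries.

(** * Suspension by an involutory element *)

Section Suspension.
Variables (X : quandleType) (a : X).
Hypothesis qopK : involutive (fun x : X => qop x a).

Let qop_morph : {morph (fun x : X => qop x a) : x y / qop x y}.
Proof. by move=> x y; rewrite qopDl. Qed.

Definition tuple_act n (x : n.-tuple X) : n.-tuple X :=
  map_tuple (fun y => qop y a) x.

Lemma tuple_actK n : involutive (@tuple_act n).
Proof. by move=> x; apply: eq_from_tnth => i; rewrite !tnth_map qopK. Qed.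

Lemma face_rcons n e (x : n.+1.-tuple X) (i : 'I_n.+1) :
  face e (rcons_tuple x a) (widen_ord (leqnSn n.+1) i) =
  rcons_tuple (face e x i) a.
Proof.
have ix : (i < size x)%N by rewrite size_tuple.
apply: (@faceP _ n.+2).
rewrite -[RHS]/(rcons (face e x i) a) val_face (tnth_nth a) /= nth_rcons ix.
rewrite -(tnth_nth a) -!cats1 takel_cat ?size_tuple; last exact: ltnW.
rewrite -catA drop_cat; case: ltnP => // xi; rewrite (drop_oversize xi).
by rewrite (_ : i.+1 - size x = 0)%N ?drop0 //; lia.
Qed.

Lemma face_rcons_max n e (x : n.+1.-tuple X) :
  face e (rcons_tuple x a) ord_max = if e then tuple_act x else x.
Proof.
apply: (@faceP _ n.+2).
rewrite /= (tnth_nth a) /= nth_rcons size_tuple ltnn eqxx.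
rewrite -cats1 take_size_cat ?size_tuple // drop_oversize ?cats0; last first.
  by rewrite size_cat size_tuple addn1.
by case: e => //=; rewrite map_id.
Qed.

Definition suspension_gen n (x : n.-tuple X) : {freeg n.+1.-tuple X} :=
  << rcons_tuple x a >> + << rcons_tuple (tuple_act x) a >>.

Definition suspension n : {freeg n.-tuple X} -> {freeg n.+1.-tuple X} :=
  fglift (@suspension_gen n).

HB.instance Definition _ n := GRing.isZmodMorphism.Build _ _ (@suspension n)
  (lift_is_additive (@suspension_gen n)).

Lemma suspensionU n (x : n.-tuple X) : suspension << x >> =
  << rcons_tuple x a >> + << rcons_tuple (tuple_act x) a >>.
Proof. by rewrite /suspension liftU scale1r. Qed.

(** The faces at the entry a contribute x - x * a for the first term and
    x * a - x * a * a for the second; they cancel because a acts as an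
    involution. *)
Lemma rack_diff_suspension n (c : {freeg n.+1.-tuple X}) :
  rack_diff (suspension c) = suspension (rack_diff c).
Proof.
apply: (freeg_ext (f := @rack_diff X n.+2 \o @suspension n.+1)
                  (g := @suspension n \o @rack_diff X n.+1)) => {c} x /=.
rewrite suspensionU raddfD /= !rack_diffU /rack_diff_gen -big_split raddf_sum.
rewrite big_mkcond big_ord_recr [RHS]big_mkcond /=.
rewrite !face_rcons_max tuple_actK -scalerDr addrA subrK subrr scaler0 addr0.
apply: eq_bigr => i _; case: ifP => // _.
rewrite !face_rcons !(face_map qop_morph) -scalerDr addrACA -opprD.
rewrite -!suspensionU -raddfB.
by rewrite -signr_odd !scaler_sign; case: ifP => _; rewrite ?raddfN.
Qed.

Lemma suspension_degenerate n (c : {freeg n.-tuple X}) :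
  c \in @degenerate_chain X n -> suspension c \in @degenerate_chain X n.+1.
Proof.
move=> /allP dc; rewrite -[c]freeg_sumE raddf_sum big_seq rpred_sum // => x.
move=> /dc /existsP[i /existsP[j /andP[ij /eqP xij]]].
rewrite -[coeff x c]intz -freegU_mulz raddfMz rpredMz //= suspensionU.
have dU (y : n.-tuple X) : tnth y i = tnth y j ->
    << rcons_tuple y a >> \in @degenerate_chain X n.+1.
  move=> yij; rewrite inE domU1 /= andbT.
  apply/existsP; exists (widen_ord (leqnSn n) i).
  apply/existsP; exists (widen_ord (leqnSn n) j).
  rewrite ij !(tnth_nth a) /= !nth_rcons !size_tuple !ltn_ord -!(tnth_nth a).
  by rewrite yij eqxx.
by rewrite rpredD // dU // !tnth_map xij.
Qed.
End Suspension.

(** * Elements of order k detected by cocycles modulo k *)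

Lemma embeds_Zmod_order (V : zmodType) (k N : nat) (v : V) :
  (0 < k)%N -> (0 < N)%N -> v *+ N = 0 ->
  (forall r, v *+ r = 0 -> (k %| r)%N) ->
  embeds (Zmod k) V.
Proof.
move=> k0 N0 vN kdvd.
have exN : exists r, (0 < r)%N && (v *+ r == 0) by exists N; rewrite N0 vN eqxx.
case: (ex_minnP exN) => r /andP[r0 /eqP vr] rmin.
(* r = q k is the order of v, so q v has order k. *)
have [q rE] := dvdnP (kdvd r vr).
have q0 : (0 < q)%N by move: r0; rewrite rE muln_gt0 => /andP[].
pose f (i : Zmod k) := v *+ (q * i).
have fD i j : f (i + j) = f i + f j.
  rewrite /f -mulrnDr -mulnDr val_ZmodD // [in RHS](divn_eq (i + j) k).
  have -> : (q * ((i + j) %/ k * k + (i + j) %% k) =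
             r * ((i + j) %/ k) + q * ((i + j) %% k))%N.
    by rewrite mulnDr rE mulnA mulnAC.
  by rewrite mulrnDr mulrnA vr mul0rn add0r.
have fM : zmod_morphism f.
  by move=> i j; apply/eqP; rewrite eq_sym subr_eq -fD subrK.
pose fA : {additive Zmod k -> V} :=
  HB.pack f (GRing.isZmodMorphism.Build _ _ f fM).
exists fA; apply: raddf_inj => i /= fi0; apply: ord_inj => /=.
apply/eqP; rewrite -leqn0 leqNgt; apply/negP=> i0.
have := rmin (q * i)%N; rewrite muln_gt0 q0 i0 -/(f i) fi0 eqxx => /(_ isT).
by rewrite rE leq_pmul2l // leqNgt ltn_Zmod.
Qed.

Section Evaluation.
Variables (K : choiceType) (f : K -> int).

Definition evaluation : {freeg K} -> int := fglift (f : K -> int^o).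

HB.instance Definition _ := GRing.isZmodMorphism.Build _ _ evaluation
  (lift_is_additive (f : K -> int^o)).

Lemma evaluationU x : evaluation << x >> = f x.
Proof. by rewrite /evaluation liftU scale1r. Qed.
End Evaluation.

Lemma dvdz_freeg (K : choiceType) (d : int) (g : {additive {freeg K} -> int})
    (c : {freeg K}) :
  {in dom c, forall x, (d %| g << x >>)%Z} -> (d %| g c)%Z.
Proof.
move=> dg; rewrite -[c]freeg_sumE raddf_sum big_seq rpred_sum // => x xc.
by rewrite -[coeff x c]intz -freegU_mulz raddfMz /= rpredMz // dg.
Qed.

(** A quandle cocycle [f] modulo k whose value on the cycle [z] is prime to k
    forces k to divide the order of the class of [z]; the chain [w] makes that
    order finite. *)
Lemma embeds_Zmod_quandle_homology (X : quandleType) (n k N : nat)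
    (z : {freeg n.-tuple X}) (w : {freeg n.+1.-tuple X})
    (f : n.-tuple X -> int) :
  (0 < k)%N -> (0 < N)%N -> rack_diff z = 0 ->
  z *+ N - rack_diff w \in @degenerate_chain X n ->
  (forall x, degenerate x -> (k %| f x)%Z) ->
  (forall x : n.+1.-tuple X, (k %| evaluation f (rack_diff << x >>))%Z) ->
  coprimez k (evaluation f z) ->
  embeds (Zmod k) (quandle_homology QuandleH X n).
Proof.
move=> k0 N0 dz zN fdeg fdiff fz.
have zcyc : qclass z \in @Defs.cycle (quandle_complex X) n.
  by rewrite inE diff_qclass dz raddf0.
pose zc := Subgroup zcyc; pose v : quandle_homology QuandleH X n := hclass zc.
have val_mul r : val (zc *+ r) = qclass (z *+ r) by rewrite !raddfMn.
apply: (@embeds_Zmod_order _ k N v) => //.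
  rewrite -raddfMn; apply/hclass0P; exists (qclass w).
  rewrite val_mul diff_qclass -/(@qclass X n _); apply/eqP.
  by rewrite eq_sym -subr_eq0 -raddfB qclass_eq0.
move=> r; rewrite -raddfMn => /hclass0P[x]; rewrite val_mul.
have [c ->] := qclassP x; rewrite diff_qclass -/(@qclass X n _) => /eqP.
rewrite eq_sym -subr_eq0 -raddfB qclass_eq0 => /allP cdeg.
have: (k %| evaluation f (z *+ r - rack_diff c))%Z.
  by apply: dvdz_freeg => y /cdeg /fdeg; rewrite /= evaluationU.
have: (k %| evaluation f (rack_diff c))%Z.
  by apply: (dvdz_freeg (g := evaluation f \o @rack_diff X n.+1)) => y _;
    apply: fdiff.
move=> kc; rewrite raddfB rpredBr // raddfMn -mulr_natr natz Gauss_dvdzr //.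
Qed.

(** * A torsion cycle of the odd dihedral quandles *)

(** These names fix the quandle of the entries, so that entries computed in the
    group Z/k are read in the dihedral quandle. *)
Definition cell2 (X : quandleType) (a b : X) : {freeg 2.-tuple X} :=
  << [tuple a; b] >>.
Definition cell3 (X : quandleType) (a b c : X) : {freeg 3.-tuple X} :=
  << [tuple a; b; c] >>.
Definition cell4 (X : quandleType) (a b c d : X) : {freeg 4.-tuple X} :=
  << [tuple a; b; c; d] >>.

Lemma rack_diff_cell3 (X : quandleType) (a b c : X) :
  rack_diff (cell3 a b c) = (cell2 a c - cell2 (qop a b) c)
    - (cell2 a b - cell2 (qop a c) (qop b c)).
Proof. exact: rack_diff3. Qed.

Lemma rack_diff_cell4 (X : quandleType) (a b c d : X) :
  rack_diff (cell4 a b c d) = (cell3 a c d - cell3 (qop a b) c d)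
    - (cell3 a b d - cell3 (qop a c) (qop b c) d)
    + (cell3 a b c - cell3 (qop a d) (qop b d) (qop c d)).
Proof. exact: rack_diff4. Qed.

Section OddDihedralCycle.
Variable k : nat.
Hypothesis k_odd : odd k.
Let k0 : (0 < k)%N. Proof. exact: odd_gt0. Qed.
Local Notation Z := 'I_k.-1.+1.
Local Notation X := (dihedral k).
Implicit Types (a b c i t u v y : Zmod k).

Lemma qopE a b : qop (a : X) b = b *+ 2 - a.
Proof. by []. Qed.

Lemma qop_add a d : qop (a : X) (a + d : Zmod k) = a + d + d.
Proof.
by rewrite qopE mulr2n addrAC [a + d - a]addrAC subrr add0r addrCA addrA.
Qed.

Lemma mulrn_Zmod a : a *+ k = 0.
Proof.
apply: ord_inj.
by rewrite -[a *+ k]/((a : Z) *+ k) Zp_mulrn val_inZmod // modnMl.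
Qed.

Lemma double_inj : injective (fun a : Zmod k => a *+ 2).
Proof.
move=> a b /(congr1 (fun x => x *+ k.+1./2)); rewrite -!mulrnA mul2n.
by rewrite even_halfK /= ?k_odd // !mulrS !mulrn_Zmod !addr0.
Qed.

Definition Zmod_one : Zmod k := inZp 1.
Local Notation one := Zmod_one.

Definition Zmod_half : Zmod k := one *+ k.+1./2.

Lemma Zmod_halfD : Zmod_half + Zmod_half = one.
Proof.
by rewrite -mulr2n -mulrnA muln2 even_halfK /= ?k_odd // mulrS mulrn_Zmod addr0.
Qed.

Lemma sumr_const_Zmod (V : zmodType) (x : V) : \sum_(i : Z) x = x *+ k.
Proof. by rewrite sumr_const card_ord prednK. Qed.

Lemma sum_shift (V : zmodType) (F : Z -> V) t :
  \sum_(i : Z) F (i + t : Zmod k) = \sum_(i : Z) F i.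
Proof. by rewrite [RHS](reindex_inj (addIr (t : Zmod k))). Qed.

Lemma sum_qopl (V : zmodType) (F : Z -> V) b :
  \sum_(a : Z) F (qop (a : X) b) = \sum_(a : Z) F a.
Proof. by rewrite [RHS](reindex_inj (inv_inj (@dihedral_opK k b))). Qed.

Lemma sum_qopr (V : zmodType) (F : Z -> V) a :
  \sum_(b : Z) F (qop (a : X) b) = \sum_(b : Z) F b.
Proof.
rewrite [RHS](reindex_inj (h := fun b => qop (a : X) b)) // => b c.
by rewrite !qopE => /addIr /double_inj.
Qed.

(** A shadow cycle of the torus knot T(2, k): the arcs are coloured 0, ..., k - 1
    in order, and c colours one of the two regions adjacent to all crossings. *)
Definition polygon c : {freeg 3.-tuple X} :=
  \sum_(i : Z) cell3 (c : X) i (i + one : Zmod k).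

(** Because i * (i + 1) = i + 2, the faces of consecutive tuples cancel around
    Z/k. *)
Lemma rack_diff_polygon c : rack_diff (polygon c) = 0.
Proof.
rewrite raddf_sum /=.
under eq_bigr do rewrite rack_diff_cell3 qop_add.
rewrite sumrB !sumrB.
rewrite (sum_shift (fun i => cell2 (c : X) i) one).
pose F (i : Z) := cell2 (qop (c : X) i) (i + one : Zmod k).
rewrite -[X in _ - (_ - X)]/(\sum_(i : Z) F (i + one : Zmod k)) sum_shift.
by rewrite subrr.
Qed.

Definition polygon_fill c y : {freeg 4.-tuple X} :=
  \sum_(i : Z) cell4 (c : X) y i (i + one : Zmod k).

(** Deleting y leaves the difference of the two polygons; the remaining faces
    cancel around Z/k as they do for the polygon itself. *)
Lemma rack_diff_polygon_fill c y :
  rack_diff (polygon_fill c y) = polygon c - polygon (qop (c : X) y).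
Proof.
rewrite raddf_sum /=.
under eq_bigr do rewrite rack_diff_cell4 qop_add.
rewrite big_split !sumrB /=.
rewrite (sum_shift (fun i => cell3 (c : X) y i) one).
pose F (i : Z) := cell3 (qop (c : X) i) (qop (y : X) i) (i + one : Zmod k).
rewrite -[X in _ + (_ - X)]/(\sum_(i : Z) F (i + one : Zmod k)) sum_shift.
by rewrite subrK.
Qed.

Definition diagonals d : {freeg 3.-tuple X} :=
  \sum_(c : Z) \sum_(t : Z) cell3 (c : X) t (t + d : Zmod k).

Lemma diagonals_shift d s :
  \sum_(c : Z) \sum_(t : Z)
    cell3 (c : X) (t + s : Zmod k) (t + s + d : Zmod k) =
  diagonals d.
Proof.
apply: eq_bigr => c _.
exact: (sum_shift (fun t => cell3 (c : X) t (t + d : Zmod k))).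
Qed.

Lemma diagonals_qop d s (g : Z -> Z) :
  \sum_(c : Z) \sum_(t : Z)
    cell3 (qop (c : X) (g t)) (t + s : Zmod k) (t + s + d : Zmod k) =
  diagonals d.
Proof.
rewrite -(diagonals_shift d s) exchange_big [RHS]exchange_big.
apply: eq_bigr => t _.
exact: (sum_qopl (fun c =>
  cell3 (c : X) (t + s : Zmod k) (t + s + d : Zmod k))).
Qed.

Definition triangles u v : {freeg 4.-tuple X} :=
  \sum_(c : Z) \sum_(t : Z)
    cell4 (c : X) t (t + u : Zmod k) (t + u + v : Zmod k).

(** Once summed over c, a face does not change when c is moved by the action,
    and each face of (c, t, t + u, t + u + v) is a family of pairs with constant
    difference. *)
Lemma rack_diff_triangles u v :
  rack_diff (triangles u v) =
  diagonals u - diagonals (- u) - (diagonals (u + v) - diagonals (v - u)).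
Proof.
have faces c t :
  rack_diff (cell4 (c : X) t (t + u : Zmod k) (t + u + v : Zmod k)) =
  (cell3 (c : X) (t + u : Zmod k) (t + u + v : Zmod k)
   - cell3 (qop (c : X) t) (t + u : Zmod k) (t + u + v : Zmod k))
  - (cell3 (c : X) t (t + (u + v) : Zmod k)
     - cell3 (qop (c : X) (t + u : Zmod k)) (t + (u + u) : Zmod k)
         (t + (u + u) + (v - u) : Zmod k))
  + (cell3 (c : X) t (t + u : Zmod k)
     - cell3 (qop (c : X) (t + u + v : Zmod k))
         (t + (u + v + (u + v)) : Zmod k) (t + (u + v + (u + v)) - u : Zmod k)).
  rewrite rack_diff_cell4 !qop_add -[in qop (t : X) _]addrA !qop_add -!addrA.
  by rewrite (_ : u + (v - u) = v) // addrC subrK.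
rewrite raddf_sum /=; under eq_bigr do rewrite raddf_sum /=.
under eq_bigr do under eq_bigr do rewrite faces.
under eq_bigr do rewrite big_split /= !sumrB.
rewrite big_split /= !sumrB.
rewrite diagonals_shift !diagonals_qop.
by rewrite subrr sub0r addrC.
Qed.

(** Summing [rack_diff_triangles] over v cancels the last two terms, which shows
    that k (diagonals u - diagonals (- u)) is a boundary; the case u = v turns
    that difference into diagonals (2 u) - diagonals 0. *)
Definition diagonals_fill : {freeg 4.-tuple X} :=
  \sum_(v : Z) triangles Zmod_half v - triangles Zmod_half Zmod_half *+ k.

Lemma rack_diff_diagonals_fill :
  rack_diff diagonals_fill = (diagonals one - diagonals 0) *+ k.
Proof.
rewrite raddfB raddfMn raddf_sum /=.
under eq_bigr do rewrite rack_diff_triangles.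
rewrite rack_diff_triangles Zmod_halfD subrr sumrB sumr_const_Zmod sumrB.
have -> : \sum_(v : Z) diagonals (Zmod_half + v) = \sum_(v : Z) diagonals v.
  by under eq_bigr do rewrite addrC; apply: (sum_shift diagonals).
rewrite (sum_shift diagonals) subrr subr0 -mulrnBl; congr (_ *+ k).
by rewrite opprB addrC subrK.
Qed.

Lemma diagonals0_degenerate : diagonals 0 \in @degenerate_chain X 3.
Proof.
rewrite rpred_sum // => c _; rewrite rpred_sum // => t _.
rewrite inE domU1 /= andbT addr0.
apply/existsP; exists (lift ord0 ord0).
apply/existsP; exists (lift ord0 (lift ord0 ord0)).
apply/andP; split=> //; exact: eqxx.
Qed.

Definition polygon_mult_fill c : {freeg 4.-tuple X} :=
  (\sum_(y : Z) polygon_fill c y) *+ k + diagonals_fill.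

Lemma polygon_torsion c :
  polygon c *+ (k * k) - rack_diff (polygon_mult_fill c)
    \in @degenerate_chain X 3.
Proof.
suff -> : polygon c *+ (k * k) - rack_diff (polygon_mult_fill c) =
    diagonals 0 *+ k.
  by rewrite rpredMn // diagonals0_degenerate.
rewrite raddfD raddfMn raddf_sum /= rack_diff_diagonals_fill.
under eq_bigr do rewrite rack_diff_polygon_fill.
rewrite sumrB sumr_const_Zmod (sum_qopr polygon).
rewrite mulrnA mulrnBl -[diagonals one]/(\sum_(c : Z) polygon c) mulrnBl.
rewrite addrA subrK.
by rewrite opprB addrC subrK.
Qed.
End OddDihedralCycle.

(** * Cocycles modulo k from carries *)

Section Carry.
Variable k : nat.
Hypothesis k0 : (0 < k)%N.
Local Notation X := (dihedral k).
Implicit Types a b c d e : X.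

Definition lift_int a : int := (a : nat)%:Z.
Local Notation tau := lift_int.

(** The failure of the lift to be a quandle morphism for 2 b - a on the
    integers. *)
Definition carry a b : int := ((tau (qop a b) + tau a - tau b *+ 2) %/ k)%Z.

Lemma lift_qop a b : tau (qop a b) = tau b *+ 2 - tau a + carry a b * k.
Proof.
suff kd : (k %| tau (qop a b) + tau a - tau b *+ 2)%Z.
  by rewrite /carry divzK //; ring.
have : (qop a b : Zmod k) + (a : Zmod k) = (b : Zmod k) *+ 2 by exact: subrK.
rewrite mulr2n; move: (qop a b) => q /(congr1 (@nat_of_ord _)).
rewrite !val_ZmodD // => qab.
by rewrite /lift_int mulr2n -!PoszD -eqz_mod_dvd !modz_nat qab.
Qed.

Lemma carryxx a : carry a a = 0.
Proof. by rewrite /carry qopxx mulr2n subrr div0z. Qed.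

(** Up to the factor k, the carry is the coboundary of the lift in the complex
    where every element of the quandle acts by -1; this is its cocycle relation,
    obtained from two expansions of the lift of (a * b) * c = (a * c) * (b * c). *)
Lemma carry_qop a b c :
  carry (qop a c) (qop b c) =
  carry a c + carry (qop a b) c - carry a b - carry b c *+ 2.
Proof.
have kn0 : k%:Z != 0 by rewrite eqz_nat -lt0n.
apply: (mulIf kn0).
have carryE x y : carry x y * k = tau (qop x y) + tau x - tau y *+ 2.
  by rewrite lift_qop; ring.
by rewrite mulr2n !mulrBl !mulrDl !carryE -qopDl; ring.
Qed.

(** For k prime this is Mochizuki's 3-cocycle up to a coboundary, with the lift to
    [0, k) in place of the lift by k-th powers modulo k^2. *)
Definition carry3 (x : 3.-tuple X) : int :=
  let x_ := nth (tnth x ord0) x in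
  (tau (x_ 0%N) - tau (x_ 1%N)) * carry (x_ 1%N) (x_ 2%N).

(** The simplicial coboundary of the carry.  It inherits the cocycle relation of
    the carry one degree higher ([carry_triple_qop]), and it vanishes when two
    consecutive arguments agree. *)
Definition carry_triple a b c : int := carry a b - carry a c + carry b c.

Definition carry4 (x : 4.-tuple X) : int :=
  let x_ := nth (tnth x ord0) x in
  (tau (x_ 0%N) - tau (x_ 1%N)) * carry_triple (x_ 1%N) (x_ 2%N) (x_ 3%N).

(** Modulo k the difference of the lifts of two elements changes sign when both
    are moved by the same element; the factor left over is then the relation
    [carry_qop]. *)
Lemma carry3_cocycle (x : 4.-tuple X) :
  (k %| evaluation carry3 (rack_diff << x >>))%Z.
Proof.
case/tupleP: x => a x; case/tupleP: x => b x.
case/tupleP: x => c x; case/tupleP: x => d x.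
rewrite (tuple0 x) rack_diff4 !(raddfB, raddfD) /= !evaluationU /carry3 /=.
rewrite carry_qop !lift_qop; apply/dvdzP.
(* The quotient collects the multiples of k introduced by [lift_qop]. *)
exists (- carry a b * carry c d + (carry a c - carry b c) * carry (qop b c) d
  - (carry a d - carry b d)
    * (carry b d + carry (qop b c) d - carry b c - carry c d *+ 2)).
ring.
Qed.

Lemma carry_triple_qop a b c d :
  carry_triple (qop a d) (qop b d) (qop c d) =
  carry_triple b c d *+ 2 - carry_triple a c d - carry_triple (qop a b) c d
  + carry_triple a b d + carry_triple (qop a c) (qop b c) d
  - carry_triple a b c.
Proof. rewrite /carry_triple !carry_qop; ring. Qed.

Lemma carry4_cocycle (x : 5.-tuple X) :
  (k %| evaluation carry4 (rack_diff << x >>))%Z.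
Proof.
case/tupleP: x => a x; case/tupleP: x => b x.
case/tupleP: x => c x; case/tupleP: x => d x.
case/tupleP: x => e x.
rewrite (tuple0 x) rack_diff5 !(raddfB, raddfD) /= !evaluationU /carry4 /=.
rewrite (carry_triple_qop b c d e) !lift_qop; apply/dvdzP.
exists (- carry a b * carry_triple c d e
  + (carry a c - carry b c) * carry_triple (qop b c) d e
  - (carry a d - carry b d) * carry_triple (qop b d) (qop c d) e
  + (carry a e - carry b e)
    * (carry_triple c d e *+ 2 - carry_triple b d e - carry_triple (qop b c) d e
       + carry_triple b c e + carry_triple (qop b d) (qop c d) e
       - carry_triple b c d)).
ring.
Qed.

Lemma carry3_degenerate (x : 3.-tuple X) : degenerate x -> (k %| carry3 x)%Z.
Proof.
case/existsP=> i /existsP[j /andP[/eqP ij]].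
have : (i < 2)%N by have := ltn_ord j; rewrite ij.
rewrite /carry3; move: (tnth x ord0) => d; rewrite !(tnth_nth d) ij.
case: i {ij} => -[|[|i]] //= _ _ /eqP ->.
  by rewrite subrr mul0r dvdz0.
by rewrite carryxx mulr0 dvdz0.
Qed.

Lemma carry4_degenerate (x : 4.-tuple X) : degenerate x -> (k %| carry4 x)%Z.
Proof.
case/existsP=> i /existsP[j /andP[/eqP ij]].
have : (i < 3)%N by have := ltn_ord j; rewrite ij.
rewrite /carry4 /carry_triple; move: (tnth x ord0) => d.
rewrite !(tnth_nth d) ij.
case: i {ij} => -[|[|[|i]]] //= _ _ /eqP ->.
- by rewrite subrr mul0r dvdz0.
- by rewrite carryxx sub0r addNr mulr0 dvdz0.
- by rewrite carryxx addr0 subrr mulr0 dvdz0.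
Qed.
End Carry.

(** * Torsion classes of the odd dihedral quandles *)

Section OddDihedralTorsion.
Variable k : nat.
Hypotheses (k_odd : odd k) (k1 : (1 < k)%N).
Let k0 : (0 < k)%N. Proof. exact: odd_gt0. Qed.
Local Notation Z := 'I_k.-1.+1.
Local Notation X := (dihedral k).
Local Notation tau := (@lift_int k).
Local Notation one := (Zmod_one k).
Implicit Types (a i j : Zmod k).

Lemma lift0 : tau (0 : Zmod k) = 0.
Proof. by []. Qed.

Lemma lift_addone i :
  tau (i + one : Zmod k) = tau i + 1 - (i == - one)%:R * k%:Z.
Proof.
have v1 : one = 1%N :> nat by rewrite val_inZmod // modn_small.
have i_lt := ltn_Zmod i k0.
have vE : (i + one)%R = ((i + 1) %% k)%N :> nat by rewrite val_ZmodD // v1.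
have -> : (i == - one) = ((i + 1) %% k == 0)%N by rewrite -addr_eq0 -vE.
rewrite /lift_int vE addn1; have [ik|ik] := eqVneq (i.+1 : nat) k.
  by rewrite ik modnn eqxx mul1r; lia.
by rewrite modn_small; lia.
Qed.

Lemma lift_opp i : tau (- i : Zmod k) = (i != 0)%:R * k%:Z - tau i.
Proof.
have i_lt := ltn_Zmod i k0; have ni_lt := ltn_Zmod (- i) k0.
have := congr1 (@nat_of_ord _) (subrr i).
rewrite val_ZmodD // -[nat_of_ord 0]/0%N.
have -> : (i != 0) = (0 < i)%N by rewrite lt0n.
rewrite /lift_int; move: (nat_of_ord (- i)) ni_lt => n ni_lt.
case: (posnP i) => [-> | i0]; first by rewrite mul0r add0n modn_small //; lia.
rewrite mul1r => /eqP; rewrite -/(k %| _)%N => /dvdnP[[|[|q]]]; nia.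
Qed.

Lemma carryE a b :
  carry (a : X) b * k%:Z = tau (qop (a : X) b) + tau a - tau b *+ 2.
Proof. by rewrite lift_qop //; ring. Qed.

Let kn0 : k%:Z != 0. Proof. by rewrite eqz_nat -lt0n. Qed.

(** Carries occur only where the count 0, 1, ..., k - 1 wraps around, at the two
    pairs whose triple i, i + 1, i + 2 crosses from k - 1 to 0. *)
Lemma carry_addone i :
  carry (i : X) (i + one : Zmod k) = (i == - one)%:R - (i + one == - one)%:R.
Proof.
by apply: (mulIf kn0); rewrite carryE qop_add !lift_addone; ring.
Qed.

Lemma carry0r i : carry (i : X) (0 : Zmod k) = (i != 0)%:R.
Proof.
apply: (mulIf kn0); rewrite carryE qopE mul0rn sub0r lift_opp.
by rewrite lift0; ring.
Qed.

Lemma carry_opp i j :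
  carry ((- i : Zmod k) : X) (- j : Zmod k) =
  (qop (i : X) j != 0 :> Zmod k)%:R + (i != 0)%:R - (j != 0)%:R *+ 2
  - carry (i : X) j.
Proof.
apply: (mulIf kn0); rewrite !mulrBl carryE mulrDl carryE.
have -> : qop ((- i : Zmod k) : X) (- j : Zmod k) =
    (- (qop (i : X) j : Zmod k) : Zmod k).
  by rewrite !qopE mulNrn opprB opprK addrC.
by rewrite !lift_opp; ring.
Qed.

Let addone_eq i j : (i + one == j) = (i == j - one).
Proof. by rewrite [RHS]eq_sym subr_eq eq_sym. Qed.

Let add_one_eq0 i : (i + one == 0) = (i == - one).
Proof. by rewrite addr_eq0. Qed.

Lemma carry_triple_addone i :
  carry_triple (i : X) (i + one : Zmod k) (0 : Zmod k) =
  (i == 0)%:R - (i + one == - one)%:R.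
Proof.
rewrite /carry_triple carry_addone !carry0r add_one_eq0.
by case: (i == - one); case: (i == 0) => /=; ring.
Qed.

(** In the suspension by 0 the second half consists of the negatives of the
    tuples of the first; by this lemma it contributes nothing to the value in
    degree 4. *)
Lemma carry_triple_opp_addone i :
  carry_triple ((- i : Zmod k) : X) (- (i + one) : Zmod k) (0 : Zmod k) = 0.
Proof.
rewrite /carry_triple carry_opp !carry0r qop_add carry_addone.
rewrite !oppr_eq0 !add_one_eq0.
by case: (i == - one); case: (i == 0); case: (i + one == - one) => /=; ring.
Qed.

Lemma lift_opp_one : tau (- one) = k%:Z - 1.
Proof.
by have := lift_addone (- one); rewrite addNr eqxx lift0; lia.
Qed.

Lemma lift_opp_two : tau (- one - one) = k%:Z - 2.
Proof.
have := lift_addone (- one - one); rewrite subrK lift_opp_one.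
have -> : (- one - one == - one) = false.
  rewrite -subr_eq0 opprK subrK oppr_eq0.
  apply/negP=> /eqP/(congr1 (@nat_of_ord _)).
  by rewrite val_inZmod // modn_small.
lia.
Qed.

Lemma sum_delta (F : Z -> int) (j : Z) : \sum_(i : Z) F i * (i == j)%:R = F j.
Proof.
rewrite (bigD1 j) //= eqxx mulr1 big1 ?addr0 // => i /negbTE ->.
by rewrite mulr0.
Qed.

Lemma carry3_polygon : evaluation (@carry3 k) (polygon (0 : Zmod k)) = -1.
Proof.
rewrite raddf_sum /=.
under eq_bigr => i _ do
  rewrite evaluationU /carry3 /= carry_addone addone_eq mulrBr.
rewrite sumrB !sum_delta lift_opp_one lift_opp_two; lia.
Qed.

Let qopK0 : involutive (fun x : X => qop x (0 : Zmod k)).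
Proof. exact: dihedral_opK. Qed.

Lemma carry4_suspension_polygon :
  evaluation (@carry4 k) (suspension ((0 : Zmod k) : X) (polygon (0 : Zmod k)))
  = k%:Z - 2.
Proof.
rewrite !raddf_sum /=.
under eq_bigr => i _.
  rewrite suspensionU raddfD /= !evaluationU /carry4 /= !qopE mul0rn !sub0r.
  rewrite carry_triple_opp_addone mulr0 addr0 carry_triple_addone addone_eq.
  rewrite mulrBr.
  over.
rewrite sumrB !sum_delta lift_opp_two lift0; lia.
Qed.

Theorem odd_dihedral_H3 : embeds (Zmod k) (quandle_homology QuandleH X 3).
Proof.
apply: (@embeds_Zmod_quandle_homology X 3 k (k * k) (polygon (0 : Zmod k))
          (polygon_mult_fill (0 : Zmod k)) (@carry3 k)) => //.
- by rewrite muln_gt0 k0.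
- exact: rack_diff_polygon.
- exact: polygon_torsion.
- exact: carry3_degenerate.
- exact: carry3_cocycle.
- by rewrite carry3_polygon /coprimez /gcdz abszN1 gcdn1.
Qed.

Theorem odd_dihedral_H4 : embeds (Zmod k) (quandle_homology QuandleH X 4).
Proof.
apply: (@embeds_Zmod_quandle_homology X 4 k (k * k)
          (suspension ((0 : Zmod k) : X) (polygon (0 : Zmod k)))
          (suspension ((0 : Zmod k) : X) (polygon_mult_fill (0 : Zmod k)))
          (@carry4 k)) => //.
- by rewrite muln_gt0 k0.
- by rewrite rack_diff_suspension // rack_diff_polygon raddf0.
- rewrite rack_diff_suspension // -raddfMn -raddfB.
  exact/suspension_degenerate/polygon_torsion.
- exact: carry4_degenerate.
- exact: carry4_cocycle.
- rewrite carry4_suspension_polygon /coprimez /gcdz subzn // !absz_nat eqz_nat.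
  rewrite -[X in gcdn X _](subnK k1) gcdnC gcdnDl -/(coprime _ _).
  by rewrite coprimen2 oddB // k_odd.
Qed.
End OddDihedralTorsion.

(** * Torsion in composite dihedral quandles *)

Theorem corollary5p3 (m k n : nat) (W : homology_theory) :
  (1 <= m)%N -> (1 <= k)%N -> (1 <= n)%N ->
  [/\ gcdn m k = 1%N ->
        isomorphic (Zmod (m * k)) (Zmod m * Zmod k)%type /\
        embeds (tor (quandle_homology W (dihedral m) n) *
                tor (quandle_homology W (dihedral k) n))%type
               (quandle_homology W (dihedral (m * k)) n),
      odd k ->
        embeds (tor (quandle_homology W (dihedral k) n) *
                tor (quandle_homology W (dihedral k) n))%type
               (quandle_homology W (dihedral (2 * k)) n)
    & odd k -> prime k -> gcdn m k = 1%N ->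
        embeds (Zmod k) (quandle_homology QuandleH (dihedral (m * k)) 3) /\
        embeds (Zmod k) (quandle_homology QuandleH (dihedral (m * k)) 4)].
Proof.
move=> m0 k0; case: n => // n _; split.
- move=> /eqP mk; split; first exact: Zmod_coprime_product.
  exact: embeds_tor_coprime.
- exact: embeds_tor_double.
move=> k_odd /prime_gt1 k1 mk.
have km : coprime k m by rewrite coprime_sym; apply/eqP.
have injk d := can_inj (@incl_mapK QuandleH _ _
  (coprime_retract k0 m0 km (mulnC m k)) d).
split; apply: (embeds_comp (injk _)).
  exact: odd_dihedral_H3.
exact: odd_dihedral_H4.
Qed.
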